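(* Let $R>0$ and $H=1/(\varepsilon R)$. Then $H$ is the mean curvature of $\Sigma_R$ and, writing $\varrho=\tau\varepsilon |z|$, the following hold. (a) At any point $(z,t)\in\Sigma_R^*$ the second fundamental form $h=(h_{ij})_{i,j=1,2}$, $h_{ij}=\langle\nabla_{X_i}\mathcal N,X_j\rangle$, of $\Sigma_R$ with respect to the frame $X_1,X_2$ is $$h=\frac{1}{1+\varrho^2}\begin{pmatrix} H(1+2\varrho^2) & \tau\varrho^2\\ \tau\varrho^2 & H\end{pmatrix}.$$ (b) The principal curvatures of $\Sigma_R$ at $(z,t)\in\Sigma_R$ are $$\kappa_1=H+\frac{\varrho^2}{1+\varrho^2}\sqrt{H^2+\tau^2},\qquad \kappa_2=H-\frac{\varrho^2}{1+\varrho^2}\sqrt{H^2+\tau^2}.$$ (c) Outside the north and south poles, principal directions (corresponding to $\kappa_1$ and $\kappa_2$ respectively) are given by $$K_1=\cos\beta\, X_1+\sin\beta\, X_2,\qquad K_2=-\sin\beta\, X_1+\cos\beta\, X_2,$$ where $\beta=\beta_H\in(-\pi/4,\pi/4)$ is the angle $$\beta_H=\arctan\left(\frac{\tau}{H+\sqrt{H^2+\tau^2}}\right).$$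
   Context: Fix real numbers $\varepsilon>0$, $\tau\neq 0$ and set $\sigma=\tau\varepsilon^4$. $H^1$ denotes the Heisenberg group $\mathbb C\times\mathbb R\ni(z,t)$, $z=x+iy$, with group law $(z,t)\cdot(z',t')=(z+z',t+t'+\sigma(yx'-xy'))$, and left-invariant vector fields $$X=\frac1\varepsilon\Big(\frac{\partial}{\partial x}+\sigma y\frac{\partial}{\partial t}\Big),\quad Y=\frac1\varepsilon\Big(\frac{\partial}{\partial y}-\sigma x\frac{\partial}{\partial t}\Big),\quad T=\varepsilon^2\frac{\partial}{\partial t},$$ so that $[X,Y]=-2\tau T$ and $[X,T]=[Y,T]=0$. $H^1$ carries the left-invariant Riemannian metric $g=\langle\cdot,\cdot\rangle$ making $X,Y,T$ orthonormal; $\nabla$ is its Levi-Civita connection. Let $\omega(r)=\sqrt{1+\tau^2\varepsilon^2r^2}$. For $R>0$ and $0\le r\le R$ let $$f(r;R)=\frac{\varepsilon^2}{2\tau}\Big[\omega(R)^2\arctan\Big(\tau\varepsilon\frac{\sqrt{R^2-r^2}}{\omega(r)}\Big)+\tau\varepsilon\,\omega(r)\sqrt{R^2-r^2}\Big],$$ and $\Sigma_R=\{(z,t)\in H^1: |z|\le R,\ |t|=f(|z|;R)\}$ (a compact smooth embedded sphere). Its north and south poles are $N=(0,f(0;R))$ and $S=-N=(0,-f(0;R))$, and $\Sigma_R^*=\Sigma_R\setminus\{N,S\}$. $\mathcal N$ is the exterior unit normal to $\Sigma_R$. The mean curvature is one half of the trace of the shape operator $W\mapsto\nabla_W\mathcal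 N$; principal curvatures and directions are the eigenvalues and eigenvectors of this shape operator. With $r=|z|$, set $$a=\frac{\omega(r)}{r\,\omega(R)},\quad b=\pm\frac{\sqrt{R^2-r^2}}{rR\,\omega(R)},\quad c=\frac{r\,\omega(R)}{R\,\omega(r)},\quad p=\pm\tau\varepsilon\frac{\sqrt{R^2-r^2}}{\omega(r)},$$ with sign $+$ for $t\ge0$ and sign $-$ for $t\le 0$. The frame $X_1,X_2$ of $T\Sigma_R^*$ is $$X_1=-a\big((y-xp)X-(x+yp)Y\big),\qquad X_2=-b\big((x+yp)X+(y-xp)Y\big)+cT.$$ It is orthonormal and satisfies $\langle X_1,T\rangle=0$. *)

(* Defs.v *)
From HB Require Import structures.
From mathcomp Require Import all_boot all_order all_algebra.
From mathcomp Require Import all_classical all_reals all_analysis.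
From mathcomp Require Import ring.

Set Implicit Arguments.
Unset Strict Implicit.
Unset Printing Implicit Defensive.

Import Order.TTheory GRing.Theory Num.Theory.
Import numFieldNormedType.Exports.

Local Open Scope classical_set_scope.
Local Open Scope ring_scope.

(* Points of R^3 are row vectors of coordinates (x, y, t); a tangent vector at
   a point is the row vector of its components along d/dx, d/dy, d/dt.        *)

Definition vec3 (R : realType) (a b c : R) : 'rV[R]_3 :=
  \row_(i < 3) [:: a; b; c]`_i.

Definition mx22 (R : realType) (a b c d : R) : 'M[R]_2 :=
  \matrix_(i < 2, j < 2)
    (if i == ord0 then (if j == ord0 then a else b)
     else (if j == ord0 then c else d)).

Section RiemannianR3.
Context (R : realType).
Implicit Types (G : 'rV[R]_3 -> 'M[R]_3) (V : 'rV[R]_3 -> 'rV[R]_3).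
Implicit Types (p u v w : 'rV[R]_3).

(* A Riemannian metric is given by its Gram matrices [G p] with respect to the
   coordinate basis d/dx, d/dy, d/dt.                                         *)
Definition inner G p u v : R := (u *m G p *m v^T) ord0 ord0.

Definition partial (i : 'I_3) (phi : 'rV[R]_3 -> R) p : R :=
  'D_(delta_mx ord0 i) phi p.

(* [christoffel G p i j k] is the symbol with lower indices i, j and upper
   index k, i.e. 1/2 g^{kl} (d_i g_{jl} + d_j g_{il} - d_l g_{ij}).           *)
Definition christoffel G p (i j k : 'I_3) : R :=
  2^-1 * \sum_(l < 3) invmx (G p) k l *
    (partial i (fun q => G q j l) p + partial j (fun q => G q i l) p
     - partial l (fun q => G q i j) p).

(* The Levi-Civita covariant derivative, at [p], of the vector field [V] in
   the direction [w].                                                         *)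
Definition levi_civita G V p w : 'rV[R]_3 :=
  'D_w V p +
  \row_(k < 3) \sum_(i < 3) \sum_(j < 3)
     w ord0 i * V p ord0 j * christoffel G p i j k.

Lemma christoffel_torsion_free G p (i j k : 'I_3) :
  (forall q, (G q)^T = G q) -> christoffel G p i j k = christoffel G p j i k.
Proof.
move=> Gsym; rewrite /christoffel; congr (_ * _); apply: eq_bigr => l _.
congr (_ * (_ - _)); first by rewrite addrC.
by congr (partial l _ p); apply/funext => q; rewrite -{1}(Gsym q) mxE.
Qed.

Lemma christoffel_metric G p (l i j : 'I_3) :
  (forall q, (G q)^T = G q) -> G p \in unitmx ->
  partial l (fun q => G q i j) p =
    \sum_(m < 3) christoffel G p l i m * G p m j +
    \sum_(m < 3) christoffel G p l j m * G p i m.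
Proof.
move=> Gsym Gu.
have GsymE q a b : G q a b = G q b a by rewrite -{1}(Gsym q) mxE.
have lower a b c : \sum_(m < 3) christoffel G p a b m * G p m c =
    2^-1 * (partial a (fun q => G q b c) p + partial b (fun q => G q a c) p
            - partial c (fun q => G q a b) p).
  pose W : 'rV[R]_3 := \row_d
    (partial a (fun q => G q b d) p + partial b (fun q => G q a d) p
     - partial d (fun q => G q a b) p).
  have -> : \sum_(m < 3) christoffel G p a b m * G p m c =
      2^-1 * (W *m (invmx (G p))^T *m G p) ord0 c.
    rewrite mxE mulr_sumr; apply: eq_bigr => m _.
    rewrite /christoffel -mulrA; congr (_ * (_ * _)).
    by rewrite mxE; apply: eq_bigr => d _; rewrite !mxE mulrC.
  by rewrite trmx_inv Gsym -mulmxA mulVmx // mulmx1 mxE.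
have -> : \sum_(m < 3) christoffel G p l j m * G p i m =
    \sum_(m < 3) christoffel G p l j m * G p m i.
  by apply: eq_bigr => m _; rewrite GsymE.
have swap d a b : partial d (fun q => G q a b) p = partial d (fun q => G q b a) p.
  by congr (partial d _ p); apply/funext => q; rewrite GsymE.
rewrite !lower -mulrDr (swap l j i) (swap i l j) (swap j l i).
set A := partial l _ p; set B := partial i _ p; set C := partial j _ p.
by field.
Qed.

End RiemannianR3.

(* A closed embedded surface [S] bounding the compact region [D]. *)
Section Surface.
Context (R : realType) (G : 'rV[R]_3 -> 'M[R]_3) (S D : set 'rV[R]_3).
Implicit Types (p w n : 'rV[R]_3) (k m : R) (A : 'M[R]_2).

Definition tangent p w : Prop :=
  exists gamma : R -> 'rV[R]_3,
    [/\ gamma 0 = p, \forall s \near (0 : R), S (gamma s)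
      & is_derive (0 : R) (1 : R) gamma w].

Definition is_exterior_unit_normal p n : Prop :=
  [/\ inner G p n n = 1,
      forall w, tangent p w -> inner G p n w = 0
    & \forall s \near (0 : R)^'+, ~ D (p + s *: n)].

Definition exterior_unit_normal p : 'rV[R]_3 :=
  xget 0 [set n | is_exterior_unit_normal p n].

(* A field on R^3 that is differentiable at [p] and extends the unit normal
   near [p]; for [w] tangent at [p] its covariant derivative along [w] does not
   depend on the extension.                                                   *)
Definition normal_extension p : 'rV[R]_3 -> 'rV[R]_3 :=
  xget (fun=> 0) [set V : 'rV[R]_3 -> 'rV[R]_3 | differentiable V p /\
    \forall q \near p, S q -> V q = exterior_unit_normal q].

Definition shape p w : 'rV[R]_3 := levi_civita G (normal_extension p) p w.

(* The rows of [B] form a basis of the tangent plane at [p]. *)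
Definition tangent_basis p (B : 'M[R]_(2, 3)) : Prop :=
  row_free B /\ forall w, tangent p w <-> (w <= B)%MS.

(* [A] is the matrix, acting on row vectors of coordinates, of the shape
   operator at [p] in some basis of the tangent plane.                        *)
Definition is_shape_matrix p A : Prop :=
  exists B, tangent_basis p B /\
    forall c : 'rV[R]_2, shape p (c *m B) = c *m A *m B.

Definition is_mean_curvature p m : Prop :=
  exists A, is_shape_matrix p A /\ m = \tr A / 2.

Definition is_principal_direction p k w : Prop :=
  [/\ tangent p w, w != 0 & shape p w = k *: w].

Definition is_principal_curvature p k : Prop :=
  exists w, is_principal_direction p k w.

Definition second_fundamental_form p (E1 E2 : 'rV[R]_3) : 'M[R]_2 :=
  mx22 (inner G p (shape p E1) E1) (inner G p (shape p E1) E2)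
       (inner G p (shape p E2) E1) (inner G p (shape p E2) E2).

End Surface.

Section Heisenberg.
Context (R : realType) (eps tau : R).
Implicit Types (p : 'rV[R]_3) (r rad : R).

Definition xc p : R := p ord0 ord0.
Definition yc p : R := p ord0 (@Ordinal 3 1 isT).
Definition tc p : R := p ord0 (@Ordinal 3 2 isT).
Definition zabs p : R := Num.sqrt (xc p ^+ 2 + yc p ^+ 2).

Definition sigma : R := tau * eps ^+ 4.

(* Left-invariant fields for the group law
   (z, t) (z', t') = (z + z', t + t' + sigma (y x' - x y')).                   *)
Definition fieldX p : 'rV[R]_3 := eps^-1 *: vec3 1 0 (sigma * yc p).
Definition fieldY p : 'rV[R]_3 := eps^-1 *: vec3 0 1 (- (sigma * xc p)).
Definition fieldT p : 'rV[R]_3 := vec3 0 0 (eps ^+ 2).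

Definition frame p : 'M[R]_3 :=
  \matrix_(i < 3) [:: fieldX p; fieldY p; fieldT p]`_i.

(* The metric making X, Y, T orthonormal: [u *m invmx (frame p)] is the row of
   components of [u] in the basis X, Y, T.                                    *)
Definition heis_metric p : 'M[R]_3 := invmx (frame p) *m (invmx (frame p))^T.

Definition omega r : R := Num.sqrt (1 + tau ^+ 2 * eps ^+ 2 * r ^+ 2).

Definition profile rad r : R :=
  eps ^+ 2 / (2 * tau) *
  (omega rad ^+ 2 *
     atan (tau * eps * (Num.sqrt (rad ^+ 2 - r ^+ 2) / omega r))
   + tau * eps * omega r * Num.sqrt (rad ^+ 2 - r ^+ 2)).

Definition sphere rad : set 'rV[R]_3 :=
  [set p | zabs p <= rad /\ `|tc p| = profile rad (zabs p)].

(* The region enclosed by the sphere. *)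
Definition ball_region rad : set 'rV[R]_3 :=
  [set p | zabs p <= rad /\ `|tc p| <= profile rad (zabs p)].

Definition north rad : 'rV[R]_3 := vec3 0 0 (profile rad 0).
Definition south rad : 'rV[R]_3 := - north rad.

Definition sphere_star rad : set 'rV[R]_3 :=
  sphere rad `\` [set north rad; south rad].

(* The sign of the double sign in b and p; on the sphere t = 0 forces
   |z| = rad, where b = p = 0, so the choice made at t = 0 is immaterial.      *)
Definition tsign p : R := if 0 <= tc p then 1 else -1.

Definition coef_a rad p : R := omega (zabs p) / (zabs p * omega rad).
Definition coef_b rad p : R :=
  tsign p * (Num.sqrt (rad ^+ 2 - zabs p ^+ 2) / (zabs p * rad * omega rad)).
Definition coef_c rad p : R := zabs p * omega rad / (rad * omega (zabs p)).
Definition coef_p rad p : R :=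
  tsign p * (tau * eps * (Num.sqrt (rad ^+ 2 - zabs p ^+ 2) / omega (zabs p))).

Definition frame_X1 rad q : 'rV[R]_3 :=
  - coef_a rad q *:
    ((yc q - xc q * coef_p rad q) *: fieldX q
     - (xc q + yc q * coef_p rad q) *: fieldY q).
Definition frame_X2 rad q : 'rV[R]_3 :=
  - coef_b rad q *:
    ((xc q + yc q * coef_p rad q) *: fieldX q
     + (yc q - xc q * coef_p rad q) *: fieldY q)
  + coef_c rad q *: fieldT q.

Lemma frame_unit p : 0 < eps -> frame p \in unitmx.
Proof.
move=> e0; have en0 : eps != 0 by rewrite gt_eqF.
rewrite unitmxE -det_tr det_trig; last first.
  apply/is_trig_mxP => i j; rewrite !mxE.
  by case: i => [[|[|[|i]]]] // hi; case: j => [[|[|[|j]]]] // hj _;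
    rewrite /= /fieldX /fieldY /fieldT !mxE /= ?mulr0.
rewrite unitfE !big_ord_recl big_ord0 !mxE /= !mulr1.
by rewrite !mulf_neq0 ?invr_eq0 ?expf_neq0.
Qed.

Lemma frame_orthonormal p (i j : 'I_3) : 0 < eps ->
  inner heis_metric p (row i (frame p)) (row j (frame p)) = (i == j)%:R.
Proof.
move=> e0; have rowV k : row k (frame p) *m invmx (frame p) = row k 1%:M.
  by rewrite -row_mul mulmxV ?frame_unit.
rewrite /inner /heis_metric mulmxA rowV -mulmxA -trmx_mul rowV.
by rewrite tr_row trmx1 -row_mul mul1mx !mxE.
Qed.

End Heisenberg.

(* Main.v *)
Require Import Defs.
From HB Require Import structures.
From mathcomp Require Import all_boot all_order all_algebra.
From mathcomp Require Import all_classical all_reals all_analysis.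
From mathcomp Require Import ring.

Set Implicit Arguments.
Unset Strict Implicit.
Unset Printing Implicit Defensive.

Import Order.TTheory GRing.Theory Num.Theory.
Import numFieldNormedType.Exports.

Local Open Scope classical_set_scope.
Local Open Scope ring_scope.

(** Write [k = tau eps].  The square root in the profile is singular at the
equator, so the sphere is described through the new vertical coordinate [u]
that satisfies [t = height u], where [height] is the increasing function
[C (arctan (k u) + k u / (1 + k^2 u^2))] with
[C = eps^2 (1 + k^2 R^2) / (2 tau)].  In the coordinates [(x, y, u)] the
sphere becomes the algebraic surface [r^2 + u^2 + k^2 r^2 u^2 = R^2], the
ball becomes the corresponding sublevel set ([sphereP], [ball_regionP]), and
the coefficient [p] of the frame is simply [k u].

On that surface the gradient of the level function is proportional to
[(x + k y u) X + (y - k x u) Y + u T], and the length of this vector is the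
constant [R].  The exterior unit normal is therefore
[((x + k y u) X + (y - k x u) Y + u T) / R] with [u] a differentiable function
of [t] alone: one formula, differentiable at the poles and at the equator, that
can replace the chosen extension of the normal in the definition of the shape
operator ([is_exterior_unit_normalP], [shape_unit_normal]).  For this one has to
know the tangent plane exactly ([tangentP]): every vector orthogonal to the
normal is the velocity of a curve of the sphere, obtained by projecting a
straight line radially onto the algebraic surface ([sphere_curve]).

The connection has constant coefficients in the left-invariant frame
([levi_civita_frame]), hence the shape operator is an explicit rational
expression in [x], [y], [u] ([shape_frame_comb]).  Its matrix in [X1], [X2]
gives (a).  Since [tan beta = tau / (H + sqrt (H^2 + tau^2))], rotating [X1],
[X2] by [beta] diagonalises that matrix ([principal_frame_star]); at the poles
the shape operator is [H] times the identity ([principal_frame_pole]).  An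
orthonormal tangent frame of eigenvectors determines the mean curvature and all
the principal curvatures. *)

(** * Coordinates and componentwise calculus *)

Section Coordinates.
Context (R : realType).
Implicit Types (a b c : R) (p w : 'rV[R]_3).

Lemma ord3P (P : 'I_3 -> Prop) :
  P ord0 -> P (@Ordinal 3 1 isT) -> P (@Ordinal 3 2 isT) -> forall i, P i.
Proof.
move=> P0 P1 P2 [[|[|[|//]]] hi].
- by rewrite (_ : Ordinal hi = ord0)//; apply: val_inj.
- by rewrite (_ : Ordinal hi = @Ordinal 3 1 isT)//; apply: val_inj.
- by rewrite (_ : Ordinal hi = @Ordinal 3 2 isT)//; apply: val_inj.
Qed.

Lemma sum3 (V : nmodType) (F : 'I_3 -> V) :
  \sum_(i < 3) F i = F ord0 + F (@Ordinal 3 1 isT) + F (@Ordinal 3 2 isT).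
Proof.
rewrite !big_ord_recl big_ord0 addr0 addrA.
by congr (_ + F _ + F _); apply: val_inj.
Qed.

Lemma xc_vec3 a b c : xc (vec3 a b c) = a. Proof. by rewrite /xc mxE. Qed.
Lemma yc_vec3 a b c : yc (vec3 a b c) = b. Proof. by rewrite /yc mxE. Qed.
Lemma tc_vec3 a b c : tc (vec3 a b c) = c. Proof. by rewrite /tc mxE. Qed.

Definition vec3E := (xc_vec3, yc_vec3, tc_vec3).

Lemma row3P p w : xc p = xc w -> yc p = yc w -> tc p = tc w -> p = w.
Proof.
move=> hx hy ht; apply/rowP; exact: (@ord3P (fun i => p ord0 i = w ord0 i)).
Qed.

Lemma vec3_eta p : p = vec3 (xc p) (yc p) (tc p).
Proof. by apply: row3P; rewrite vec3E. Qed.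

Lemma xcD p w : xc (p + w) = xc p + xc w. Proof. by rewrite /xc mxE. Qed.
Lemma ycD p w : yc (p + w) = yc p + yc w. Proof. by rewrite /yc mxE. Qed.
Lemma tcD p w : tc (p + w) = tc p + tc w. Proof. by rewrite /tc mxE. Qed.
Lemma xcN p : xc (- p) = - xc p. Proof. by rewrite /xc mxE. Qed.
Lemma ycN p : yc (- p) = - yc p. Proof. by rewrite /yc mxE. Qed.
Lemma tcN p : tc (- p) = - tc p. Proof. by rewrite /tc mxE. Qed.
Lemma xcZ a p : xc (a *: p) = a * xc p. Proof. by rewrite /xc mxE. Qed.
Lemma ycZ a p : yc (a *: p) = a * yc p. Proof. by rewrite /yc mxE. Qed.
Lemma tcZ a p : tc (a *: p) = a * tc p. Proof. by rewrite /tc mxE. Qed.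
Lemma xc0 : xc (0 : 'rV[R]_3) = 0. Proof. by rewrite /xc mxE. Qed.
Lemma yc0 : yc (0 : 'rV[R]_3) = 0. Proof. by rewrite /yc mxE. Qed.
Lemma tc0 : tc (0 : 'rV[R]_3) = 0. Proof. by rewrite /tc mxE. Qed.

Definition coordE := (vec3E, xcD, ycD, tcD, xcN, ycN, tcN, xcZ, ycZ, tcZ,
  xc0, yc0, tc0).

Lemma differentiable_xc p : differentiable (@xc R) p.
Proof. exact: differentiable_coord. Qed.
Lemma differentiable_yc p : differentiable (@yc R) p.
Proof. exact: differentiable_coord. Qed.
Lemma differentiable_tc p : differentiable (@tc R) p.
Proof. exact: differentiable_coord. Qed.

Lemma is_derive_mx (V : normedModType R) m n (M : V -> 'M[R]_(m, n)) x v
    (dM : 'M[R]_(m, n)) :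
  (forall i j, is_derive x v (fun q => M q i j) (dM i j)) -> is_derive x v M dM.
Proof.
move=> Md; have dM' : derivable M x v.
  by apply/derivable_mxP => i j; have [] := Md i j.
apply: DeriveDef => //; rewrite derive_mx //.
by apply/matrixP => i j; rewrite mxE; have [] := Md i j.
Qed.

Lemma is_derive_coord (V : normedModType R) m n (M : V -> 'M[R]_(m, n)) x v
    (dM : 'M[R]_(m, n)) i j :
  is_derive x v M dM -> is_derive x v (fun q => M q i j) (dM i j).
Proof.
move=> [dM1 <-]; apply: DeriveDef; first by move/derivable_mxP: dM1; apply.
by rewrite derive_mx // mxE.
Qed.

Lemma is_derive_vec3 (V : normedModType R) (f g h : V -> R) x v df dg dh :
  is_derive x v f df -> is_derive x v g dg -> is_derive x v h dh ->
  is_derive x v (fun q => vec3 (f q) (g q) (h q)) (vec3 df dg dh).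
Proof.
move=> fd gd hd; apply: is_derive_mx => i; rewrite ord1.
by apply: ord3P; rewrite !mxE /=;
  [move: fd|move: gd|move: hd]; congr (is_derive _ _ _ _);
  apply/funext => q; rewrite mxE.
Qed.

Global Instance is_derive_xc p w : is_derive p w (@xc R) (xc w).
Proof. by apply: is_derive_coord; exact: is_derive_id. Qed.
Global Instance is_derive_yc p w : is_derive p w (@yc R) (yc w).
Proof. by apply: is_derive_coord; exact: is_derive_id. Qed.
Global Instance is_derive_tc p w : is_derive p w (@tc R) (tc w).
Proof. by apply: is_derive_coord; exact: is_derive_id. Qed.

Lemma differentiable_vec3 (f g h : 'rV[R]_3 -> R) p :
  differentiable f p -> differentiable g p -> differentiable h p ->
  differentiable (fun q => vec3 (f q) (g q) (h q)) p.
Proof.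
move=> fd gd hd.
have -> : (fun q => vec3 (f q) (g q) (h q)) =
  (fun q => f q *: vec3 1 0 0) + (fun q => g q *: vec3 0 1 0) +
  (fun q => h q *: vec3 0 0 1).
  apply/funext => q; rewrite [RHS]/(_ + _ + _)/=.
  by apply: row3P; rewrite !coordE; ring.
by apply: differentiableD; [apply: differentiableD|]; exact: differentiableZl.
Qed.

End Coordinates.

Section Calculus.
Context (R : realType).

Lemma is_derive_comp (U V W : normedModType R) (F : V -> W) (g : U -> V) x v dg :
  differentiable F (g x) -> differentiable g x -> is_derive x v g dg ->
  is_derive x v (F \o g) ('D_dg F (g x)).
Proof.
move=> dF dG [_ <-]; have dFg := differentiable_comp dG dF.
apply: DeriveDef; first exact: diff_derivable.
by rewrite !deriveE // diff_comp.
Qed.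

Lemma is_derive_comp_scal (V : normedModType R) (f : R -> R) (g : V -> R) x v a b :
  is_derive (g x) 1 f a -> differentiable g x -> is_derive x v g b ->
  is_derive x v (f \o g) (a * b).
Proof.
move=> [df fE] dg hb; have df' := (derivable1_diffP f (g x)).1 df.
apply: is_derive_eq; first exact: is_derive_comp hb.
rewrite deriveE // -fE deriveE //.
have -> : b = b *: (1 : R) by rewrite /GRing.scale /= mulr1.
by rewrite linearZ /= /GRing.scale /= mulr1 mulrC.
Qed.

Lemma is_derive_gt_right (f : R -> R) (d : R) :
  is_derive (0 : R) (1 : R) f d -> 0 < d ->
  \forall s \near (0 : R)^'+, f 0 < f s.
Proof.
move=> [df fE] d0.
have : \forall h \near (0 : R)^'+, 0 < h^-1 *: (f (h *: 1 + 0) - f 0).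
  have hlim : h^-1 *: (f (h *: 1 + 0) - f 0) @[h --> (0 : R)^'] --> d.
    by rewrite -fE; exact: df.
  exact: (cvgr_gt _ (cvg_dnbhs_at_right hlim)).
move=> h1; near=> s.
have s0 : 0 < s by near: s; exact: nbhs_right_gt.
have : 0 < s^-1 *: (f (s *: 1 + 0) - f 0) by near: s.
by rewrite addr0 /GRing.scale /= mulr1 pmulr_rgt0 ?invr_gt0 // subr_gt0.
Unshelve. all: by end_near. Qed.

Lemma levi_civita_linear (G : 'rV[R]_3 -> 'M[R]_3) V p (a b : R) v w :
  differentiable V p ->
  levi_civita G V p (a *: v + b *: w) =
  a *: levi_civita G V p v + b *: levi_civita G V p w.
Proof.
move=> dV; rewrite /levi_civita !deriveE // linearD !linearZ /= !scalerDr.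
rewrite addrACA; congr (_ + _).
(* [mxE] must not see inside the symbols, which involve [invmx]. *)
move: (christoffel G p) (V p) => C Vp; apply/rowP => l.
by rewrite !mxE !sum3 !mxE; ring.
Qed.

End Calculus.

Section DifferentiablePointwise.
Context (R : realType) (V : normedModType R).
Implicit Types (f g : V -> R) (p : V).

Lemma differentiable_addf f g p : differentiable f p -> differentiable g p ->
  differentiable (fun q => f q + g q) p.
Proof. exact: differentiableD. Qed.
Lemma differentiable_subf f g p : differentiable f p -> differentiable g p ->
  differentiable (fun q => f q - g q) p.
Proof. exact: differentiableB. Qed.
Lemma differentiable_mulf f g p : differentiable f p -> differentiable g p ->
  differentiable (fun q => f q * g q) p.
Proof. exact: differentiableM. Qed.
Lemma differentiable_expf f n p : differentiable f p ->
  differentiable (fun q => f q ^+ n.+1) p.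
Proof. by move=> /(@differentiableX _ _ _ n); rewrite exprfctE. Qed.
Lemma differentiable_cstf (c : R) p : differentiable (fun=> c) p.
Proof. exact: differentiable_cst. Qed.

End DifferentiablePointwise.

(* [assumption] is for factors that are neither coordinates nor constants. *)
Ltac differentiable_tac := repeat first
  [ assumption | exact: differentiable_cstf | exact: differentiable_xc
  | exact: differentiable_yc | exact: differentiable_tc
  | apply: differentiable_expf | apply: differentiable_subf
  | apply: differentiable_addf | apply: differentiable_mulf ].

Section Sphere.
Context (R : realType) (eps tau rad : R).
Hypotheses (heps : 0 < eps) (htau : tau != 0) (hrad : 0 < rad).
Implicit Types (p q w n : 'rV[R]_3) (r u x y : R).

Local Notation k := (tau * eps).
Local Notation g := (heis_metric eps tau).
Local Notation S := (sphere eps tau rad).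
Local Notation D := (ball_region eps tau rad).
Local Notation shape := (Defs.shape g S D).
Let en0 : eps != 0. Proof. by rewrite gt_eqF. Qed.
Let rn0 : rad != 0. Proof. by rewrite gt_eqF. Qed.

(** * The Levi-Civita connection in the left-invariant frame *)

Definition frame_comb p (a b c : R) : 'rV[R]_3 :=
  a *: fieldX eps tau p + b *: fieldY eps tau p + c *: fieldT eps p.

Lemma frame_combE p a b c : frame_comb p a b c =
  vec3 (a / eps) (b / eps)
    (tau * eps ^+ 3 * (a * yc p - b * xc p) + eps ^+ 2 * c).
Proof.
by apply: row3P; rewrite /frame_comb /fieldX /fieldY /fieldT /sigma !coordE;
  field.
Qed.

Definition mx33 (l : seq (seq R)) : 'M[R]_3 := \matrix_(i, j) (nth [::] l i)`_j.

Lemma invmx_frame p : invmx (frame eps tau p) =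
  mx33 [:: [:: eps; 0; - (tau * eps ^+ 2 * yc p)];
           [:: 0; eps; tau * eps ^+ 2 * xc p];
           [:: 0; 0; eps ^- 2]].
Proof.
rewrite -[RHS](mulKmx (frame_unit tau p heps)) -[LHS]mulmx1; congr (_ *m _).
apply/matrixP; apply: ord3P; apply: ord3P;
  rewrite !mxE sum3 !mxE /= /fieldX /fieldY /fieldT /sigma ?mxE /=; by field.
Qed.

Lemma heis_metricE p : heis_metric eps tau p =
  mx33 [:: [:: eps ^+ 2 + tau ^+ 2 * eps ^+ 4 * yc p ^+ 2;
               - (tau ^+ 2 * eps ^+ 4 * (xc p * yc p)); - (tau * yc p)];
           [:: - (tau ^+ 2 * eps ^+ 4 * (xc p * yc p));
               eps ^+ 2 + tau ^+ 2 * eps ^+ 4 * xc p ^+ 2; tau * xc p];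
           [:: - (tau * yc p); tau * xc p; eps ^- 4]].
Proof.
rewrite /heis_metric invmx_frame.
by apply/matrixP; apply: ord3P; apply: ord3P; rewrite !mxE sum3 !mxE /=; field.
Qed.

Lemma invmx_heis_metric p :
  invmx (heis_metric eps tau p) = (frame eps tau p)^T *m frame eps tau p.
Proof.
have Fu := frame_unit tau p heps.
rewrite /heis_metric; set F := frame eps tau p in Fu *.
have e1 : (invmx F *m (invmx F)^T) *m (F^T *m F) = 1%:M.
  by rewrite mulmxA -(mulmxA _ _ F^T) -trmx_mul mulmxV // trmx1 mulmx1 mulVmx.
have Gu := (mulmx1_unit e1).1.
by rewrite -[RHS](mulKmx Gu) e1 mulmx1.
Qed.

Lemma inner_frame_comb p a b c a' b' c' :
  inner (heis_metric eps tau) p (frame_comb p a b c) (frame_comb p a' b' c') =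
  a * a' + b * b' + c * c'.
Proof.
have fcE e f h : frame_comb p e f h = vec3 e f h *m frame eps tau p.
  apply/rowP => j; rewrite !mxE sum3 !mxE /=.
  by rewrite /fieldX /fieldY /fieldT ?mxE.
rewrite /inner /heis_metric !fcE mulmxA mulmxK ?frame_unit //.
rewrite -mulmxA -trmx_mul mulmxK ?frame_unit //.
by rewrite !mxE sum3 !mxE.
Qed.

Lemma is_derive_heis_metric p w (i j : 'I_3) :
  is_derive p w (fun q => heis_metric eps tau q i j)
  (mx33 [:: [:: tau ^+ 2 * eps ^+ 4 * (2 * yc p * yc w);
               - (tau ^+ 2 * eps ^+ 4 * (xc w * yc p + xc p * yc w));
               - (tau * yc w)];
           [:: - (tau ^+ 2 * eps ^+ 4 * (xc w * yc p + xc p * yc w));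
               tau ^+ 2 * eps ^+ 4 * (2 * xc p * xc w); tau * xc w];
           [:: - (tau * yc w); tau * xc w; 0]] i j).
Proof.
have -> : (fun q => heis_metric eps tau q i j) = (fun q => mx33
   [:: [:: eps ^+ 2 + tau ^+ 2 * eps ^+ 4 * yc q ^+ 2;
               - (tau ^+ 2 * eps ^+ 4 * (xc q * yc q)); - (tau * yc q)];
           [:: - (tau ^+ 2 * eps ^+ 4 * (xc q * yc q));
               eps ^+ 2 + tau ^+ 2 * eps ^+ 4 * xc q ^+ 2; tau * xc q];
           [:: - (tau * yc q); tau * xc q; eps ^- 4]] i j).
  by apply/funext => q; rewrite heis_metricE.
rewrite mxE; under eq_fun do rewrite mxE.
by move: i j; apply: ord3P; apply: ord3P => /=; apply: is_derive_eq;
  rewrite /GRing.scale /=; ring.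
Qed.

Lemma invmx_heis_metricE p : invmx (g p) =
  mx33 [:: [:: eps ^- 2; 0; tau * eps ^+ 2 * yc p];
           [:: 0; eps ^- 2; - (tau * eps ^+ 2 * xc p)];
           [:: tau * eps ^+ 2 * yc p; - (tau * eps ^+ 2 * xc p);
             eps ^+ 4 + tau ^+ 2 * eps ^+ 6 * (xc p ^+ 2 + yc p ^+ 2)]].
Proof.
rewrite invmx_heis_metric.
apply/matrixP; apply: ord3P; apply: ord3P; rewrite !mxE sum3 !mxE /=;
  by rewrite /fieldX /fieldY /fieldT /sigma ?mxE /=; field.
Qed.

Lemma partial_heis_metric p (i j l : 'I_3) :
  partial i (fun q => g q j l) p =
  nth 0 [:: mx33 [:: [:: 0; - (tau ^+ 2 * eps ^+ 4 * yc p); 0];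
                     [:: - (tau ^+ 2 * eps ^+ 4 * yc p);
                         2 * (tau ^+ 2 * eps ^+ 4 * xc p); tau];
                     [:: 0; tau; 0]];
            mx33 [:: [:: 2 * (tau ^+ 2 * eps ^+ 4 * yc p);
                         - (tau ^+ 2 * eps ^+ 4 * xc p); - tau];
                     [:: - (tau ^+ 2 * eps ^+ 4 * xc p); 0; 0];
                     [:: - tau; 0; 0]]] i j l.
Proof.
rewrite /partial; have [_ ->] := is_derive_heis_metric p (delta_mx ord0 i) j l.
by move: i j l; apply: ord3P; apply: ord3P; apply: ord3P;
  rewrite /xc /yc !mxE /=; ring.
Qed.

(** Row vector of the symbols with lower indices [i], [j].  The symbols with all
indices lowered vanish whenever the last index is [t], so the [t] component
comes only from the off-diagonal entries of the inverse metric. *)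
Definition heis_christoffel p (i j : 'I_3) : 'rV[R]_3 :=
  let a := tau ^+ 2 * eps ^+ 2 in
  let b := tau ^+ 3 * eps ^+ 6 in
  let x := xc p in let y := yc p in
  let g11 := vec3 0 (- (2 * a * y)) (2 * b * x * y) in
  let g12 := vec3 (a * y) (a * x) (b * (y ^+ 2 - x ^+ 2)) in
  let g22 := vec3 (- (2 * a * x)) 0 (- (2 * b * x * y)) in
  let g13 := vec3 0 (tau / eps ^+ 2) (- (tau ^+ 2 * eps ^+ 2 * x)) in
  let g23 := vec3 (- (tau / eps ^+ 2)) 0 (- (tau ^+ 2 * eps ^+ 2 * y)) in
  nth 0 (nth [::] [:: [:: g11; g12; g13]; [:: g12; g22; g23]; [:: g13; g23; 0]]
    i) j.

Lemma christoffel_heis p (i j l : 'I_3) :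
  christoffel g p i j l = heis_christoffel p i j ord0 l.
Proof.
rewrite /christoffel sum3 !partial_heis_metric invmx_heis_metricE.
by move: i j l; apply: ord3P; apply: ord3P; apply: ord3P;
  rewrite !mxE /=; field.
Qed.

(** The only nonzero bracket is [[X, Y] = - 2 tau T], so by Koszul's formula
[nabla_X Y = - nabla_Y X = - tau T], [nabla_X T = nabla_T X = tau Y],
[nabla_Y T = nabla_T Y = - tau X] and the remaining covariant derivatives of
frame fields vanish. *)
Lemma levi_civita_frame (v1 v2 v3 : 'rV[R]_3 -> R) p (w1 w2 w3 d1 d2 d3 : R) :
  let w := frame_comb p w1 w2 w3 in
  is_derive p w v1 d1 -> is_derive p w v2 d2 -> is_derive p w v3 d3 ->
  levi_civita g (fun q => frame_comb q (v1 q) (v2 q) (v3 q)) p w =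
  frame_comb p (d1 - tau * (w2 * v3 p + w3 * v2 p))
               (d2 + tau * (w1 * v3 p + w3 * v1 p))
               (d3 + tau * (w2 * v1 p - w1 * v2 p)).
Proof.
move=> w hd1 hd2 hd3.
have -> : (fun q => frame_comb q (v1 q) (v2 q) (v3 q)) = (fun q =>
    vec3 (v1 q / eps) (v2 q / eps)
    (tau * eps ^+ 3 * (v1 q * yc q - v2 q * xc q) + eps ^+ 2 * v3 q)).
  by apply/funext => q; rewrite frame_combE.
set V := fun q => _.
have dV : is_derive p w V (vec3 (d1 / eps) (d2 / eps)
   (tau * eps ^+ 3 * (d1 * yc p + v1 p * yc w - d2 * xc p - v2 p * xc w)
     + eps ^+ 2 * d3)).
  by apply: is_derive_vec3; apply: is_derive_eq;
    rewrite /GRing.scale /=; ring.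
rewrite /levi_civita; have [_ ->] := dV.
have -> : \row_l \sum_(i < 3) \sum_(j < 3)
     w ord0 i * V p ord0 j * christoffel g p i j l =
   \sum_(i < 3) \sum_(j < 3) (w ord0 i * V p ord0 j) *: heis_christoffel p i j.
  apply/rowP => l; rewrite mxE summxE; apply: eq_bigr => i _.
  by rewrite summxE; apply: eq_bigr => j _; rewrite christoffel_heis [RHS]mxE.
have wE : w = vec3 (w1 / eps) (w2 / eps)
    (tau * eps ^+ 3 * (w1 * yc p - w2 * xc p) + eps ^+ 2 * w3).
  exact: frame_combE.
rewrite !sum3 wE /V frame_combE !mxE /= /heis_christoffel /=.
by apply: row3P; rewrite !coordE; field.
Qed.

(** * The height function and the sphere in the coordinates x, y, u *)

Lemma oneDksqr_gt0 u : 0 < 1 + k ^+ 2 * u ^+ 2.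
Proof. by rewrite -exprMn ltr_pwDl ?sqr_ge0. Qed.

Lemma omega_gt0 r : 0 < omega eps tau r.
Proof. by rewrite /omega sqrtr_gt0 -exprMn; exact: oneDksqr_gt0. Qed.

Lemma sqr_omega r : omega eps tau r ^+ 2 = 1 + k ^+ 2 * r ^+ 2.
Proof. by rewrite /omega sqr_sqrtr -exprMn // ltW ?oneDksqr_gt0. Qed.

(** A change of variable in the profile: with [P = k u] its two summands are
proportional to [arctan P] and [P / (1 + P^2)]; see [profileE]. *)
Definition height u : R :=
  eps ^+ 2 * omega eps tau rad ^+ 2 / (2 * tau) *
  (atan (k * u) + k * u / (1 + k ^+ 2 * u ^+ 2)).

Definition height' u : R :=
  eps ^+ 3 * omega eps tau rad ^+ 2 / (1 + k ^+ 2 * u ^+ 2) ^+ 2.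

Lemma height'_gt0 u : 0 < height' u.
Proof. by rewrite divr_gt0 ?mulr_gt0 ?exprn_gt0 ?omega_gt0 ?oneDksqr_gt0. Qed.

Lemma is_derive_height u : is_derive u 1 height (height' u).
Proof.
have n0 := oneDksqr_gt0 u.
have n0' : 1 + k ^+ 2 * u ^+ 2 != 0 by rewrite gt_eqF.
have d1 : is_derive u 1 (fun v : R => k * v) k.
  by apply: is_derive_eq; rewrite /GRing.scale /=; ring.
have d2 : is_derive u 1 (fun v => atan (k * v)) ((1 + (k * u) ^+ 2)^-1 * k).
  exact: (@is_derive1_comp _ (@atan R)).
have d3 : is_derive u 1 (fun v : R => 1 + k ^+ 2 * v ^+ 2) (2 * k ^+ 2 * u).
  by apply: is_derive_eq; rewrite /GRing.scale /=; ring.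
have d4 : is_derive u 1 (fun v : R => (1 + k ^+ 2 * v ^+ 2)^-1)
    (- (1 + k ^+ 2 * u ^+ 2) ^- 2 * (2 * k ^+ 2 * u)).
  exact: is_deriveV.
apply: is_derive_eq; rewrite /height' /GRing.scale /=.
by field; rewrite exprMn n0'.
Qed.

Lemma continuous_height : continuous height.
Proof.
move=> u; apply/differentiable_continuous/derivable1_diffP.
by have [] := is_derive_height u.
Qed.

Lemma le_height : {mono height : u v / u <= v}.
Proof.
apply: le_mono => u v uv.
apply: (gtr0_derive1_incr (a := u) (b := v) _ _ _ (lexx u) uv (lexx v)).
- by move=> z _; have [] := is_derive_height z.
- move=> z _; rewrite derive1E.
  by have [_ ->] := is_derive_height z; exact: height'_gt0.
- by apply: continuous_subspaceT; exact: continuous_height.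
Qed.

Lemma lt_height : {mono height : u v / u < v}.
Proof. exact: leW_mono le_height. Qed.

Lemma heightN u : height (- u) = - height u.
Proof. by rewrite /height mulrN atanN sqrrN !mulNr -opprD mulrN. Qed.

Lemma height0 : height 0 = 0.
Proof. by rewrite /height mulr0 atan0 mul0r addr0 mulr0. Qed.

Lemma norm_height u : `|height u| = height `|u|.
Proof.
have [u0|u0] := leP 0 u.
  by rewrite !ger0_norm // -height0 le_height.
by rewrite !ltr0_norm ?heightN // -height0 lt_height.
Qed.

Lemma height_surj u t : `|t| <= height u -> exists2 v, height v = t & `|v| <= u.
Proof.
move=> ht; have u0 : 0 <= u by rewrite -le_height height0 (le_trans _ ht).
have hu : height (- u) <= height u by rewrite le_height ge0_cp.
have hc : {within `[- u, u], continuous height}.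
  by apply: continuous_subspaceT; exact: continuous_height.
have htu : Order.min (height (- u)) (height u) <= t <=
    Order.max (height (- u)) (height u).
  by rewrite (min_idPl hu) (max_idPr hu) heightN -ler_norml.
have [v] := IVT (ge0_cp u0).2 hc htu.
by rewrite in_itv /= -ler_norml => vu <-; exists v.
Qed.

Lemma height_inj : injective height.
Proof.
exact: inc_inj le_height.
Qed.

(** A left inverse of [height]: the image of [height] is only a bounded
interval, and the value outside it is arbitrary. *)
Definition height_inv (t : R) : R := xget 0 [set u | height u = t].

Lemma heightK : cancel height height_inv.
Proof.
move=> u; apply: height_inj.
exact: (xgetPex 0 (P := [set v | height v = height u]) (ex_intro _ u erefl)).
Qed.

Lemma is_derive_height_inv u :
  is_derive (height u) 1 height_inv (height' u)^-1.
Proof.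
apply: is_derive_inverse.
- by near=> v; exact: heightK.
- by near=> v; exact: continuous_height.
- exact: is_derive_height.
- by rewrite gt_eqF ?height'_gt0.
Unshelve. all: by end_near. Qed.

(** The equation [level x y u = rad ^+ 2] also reads
[(1 + k^2 r^2) (1 + k^2 u^2) = 1 + k^2 rad^2]. *)
Definition level x y u : R :=
  x ^+ 2 + y ^+ 2 + u ^+ 2 + k ^+ 2 * (x ^+ 2 + y ^+ 2) * u ^+ 2.

Lemma sqr_zabs p : zabs p ^+ 2 = xc p ^+ 2 + yc p ^+ 2.
Proof. by rewrite sqr_sqrtr // addr_ge0 ?sqr_ge0. Qed.

Lemma zabs_ge0 p : 0 <= zabs p. Proof. exact: sqrtr_ge0. Qed.

(** For [P = k sqrt (R^2 - r^2) / omega r] one has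
[1 + P^2 = (omega R / omega r)^2], so that the second summand
[(omega r)^2 P] of the profile is [(omega R)^2 P / (1 + P^2)]. *)
Lemma profileE r : 0 <= r -> r <= rad ->
  profile eps tau rad r =
  height (Num.sqrt (rad ^+ 2 - r ^+ 2) / omega eps tau r).
Proof.
move=> r0 rR; rewrite /profile /height.
have wn0 : omega eps tau r != 0 by rewrite gt_eqF ?omega_gt0.
have wrn0 : omega eps tau rad != 0 by rewrite gt_eqF ?omega_gt0.
have q2 : Num.sqrt (rad ^+ 2 - r ^+ 2) ^+ 2 = rad ^+ 2 - r ^+ 2.
  by rewrite sqr_sqrtr // subr_ge0 lerXn2r ?nnegrE // ltW.
set q := Num.sqrt _ in q2 *.
have -> : k * (q / omega eps tau r) /
    (1 + k ^+ 2 * (q / omega eps tau r) ^+ 2) =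
  k * q * omega eps tau r / omega eps tau rad ^+ 2.
  have -> : 1 + k ^+ 2 * (q / omega eps tau r) ^+ 2 =
     omega eps tau rad ^+ 2 / omega eps tau r ^+ 2.
    apply: (mulIf (expf_neq0 2 wn0)); rewrite divfK ?expf_neq0 //.
    rewrite expr_div_n q2 mulrDl -mulrA divfK ?expf_neq0 //.
    by rewrite !sqr_omega; ring.
  by field; rewrite wn0 wrn0.
by field; rewrite wrn0 htau.
Qed.

Lemma le_profile u r : 0 <= r -> r <= rad ->
  (`|height u| <= profile eps tau rad r) =
  (r ^+ 2 + omega eps tau r ^+ 2 * u ^+ 2 <= rad ^+ 2).
Proof.
move=> r0 rR; rewrite profileE // norm_height le_height.
rewrite ler_pdivlMr ?omega_gt0 //.
rewrite -(@ler_pXn2r _ 2) ?nnegrE ?mulr_ge0 ?sqrtr_ge0 ?(ltW (omega_gt0 _)) //.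
rewrite sqr_sqrtr ?subr_ge0 ?lerXn2r ?nnegrE ?(ltW hrad) //.
by rewrite exprMn real_normK ?num_real // lerBrDl mulrC addrC.
Qed.

Lemma eq_profile u r : 0 <= r -> r <= rad ->
  (`|height u| == profile eps tau rad r) =
  (r ^+ 2 + omega eps tau r ^+ 2 * u ^+ 2 == rad ^+ 2).
Proof.
move=> r0 rR; rewrite profileE // norm_height (inj_eq height_inj).
have w0 := omega_gt0 r.
rewrite -(@eqrXn2 _ 2) ?divr_ge0 ?sqrtr_ge0 ?(ltW w0) //.
rewrite expr_div_n sqr_sqrtr ?subr_ge0 ?lerXn2r ?nnegrE ?(ltW hrad) //.
rewrite real_normK ?num_real // -{1}[u ^+ 2]divr1 eqr_div ?oner_neq0 ?expf_neq0
  ?(gt_eqF w0) //.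
by rewrite mulr1 eq_sym subr_eq addrC (mulrC (u ^+ 2)) [LHS]eq_sym.
Qed.

Lemma level_le_rad r u : 0 <= r ->
  r ^+ 2 + omega eps tau r ^+ 2 * u ^+ 2 <= rad ^+ 2 -> r <= rad.
Proof.
move=> r0 h; rewrite -(@ler_pXn2r _ 2) ?nnegrE ?(ltW hrad) //.
by apply: le_trans h; rewrite lerDl mulr_ge0 ?sqr_ge0.
Qed.

Lemma levelE p u : level (xc p) (yc p) u =
  zabs p ^+ 2 + omega eps tau (zabs p) ^+ 2 * u ^+ 2.
Proof. by rewrite sqr_omega sqr_zabs /level; ring. Qed.

(** This description of the ball contains no square root: unlike the one
through the profile it is differentiable across the equator. *)
Lemma ball_regionP p : ball_region eps tau rad p <->
  exists2 u, tc p = height u & level (xc p) (yc p) u <= rad ^+ 2.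
Proof.
rewrite /ball_region /=; have r0 := zabs_ge0 p; split.
  move=> [rR ht]; have := ht; rewrite profileE // => /height_surj [u hu _].
  by exists u; rewrite ?hu // levelE -le_profile // hu.
move=> [u hu]; rewrite levelE => hl.
have rR := level_le_rad r0 hl.
by split=> //; rewrite hu le_profile.
Qed.

Lemma sphereP p : sphere eps tau rad p <->
  exists2 u, tc p = height u & level (xc p) (yc p) u = rad ^+ 2.
Proof.
rewrite /sphere /=; have r0 := zabs_ge0 p; split.
  move=> [rR ht].
  have [u hu _] : exists2 u, tc p = height u & level (xc p) (yc p) u <= rad ^+ 2.
    by apply/ball_regionP; split=> //; rewrite ht.
  by exists u => //; rewrite levelE; apply/eqP; rewrite -eq_profile // -hu ht.
move=> [u hu]; rewrite levelE => hl.
have rR : zabs p <= rad by apply: (level_le_rad (u := u)) => //; rewrite hl.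
by split=> //; apply/eqP; rewrite hu eq_profile // hl.
Qed.
(** The double signs of the coefficients [b] and [p] are the sign of [u], since
[height] is odd and increasing. *)
Lemma tsign_sqrt p u : tc p = height u -> level (xc p) (yc p) u = rad ^+ 2 ->
  tsign p * Num.sqrt (rad ^+ 2 - zabs p ^+ 2) = u * omega eps tau (zabs p).
Proof.
rewrite levelE => hu <-; rewrite addrC addKr -exprMn sqrtr_sqr /tsign hu.
rewrite -height0 le_height normrM (gtr0_norm (omega_gt0 _)) mulrA mulrAC.
have [u0|u0] := leP 0 u; first by rewrite mul1r ger0_norm.
by rewrite mulN1r ltr0_norm // opprK.
Qed.

(** * Tangent planes *)

Lemma u1_neq0 u : 1 + k ^+ 2 * u ^+ 2 != 0.
Proof. by rewrite gt_eqF // oneDksqr_gt0. Qed.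

Lemma r1_neq0 p : 1 + k ^+ 2 * (xc p ^+ 2 + yc p ^+ 2) != 0.
Proof. by rewrite -sqr_zabs u1_neq0. Qed.

Definition ucoord p : R := height_inv (tc p).

(** On the sphere this is the gradient of [level_at] divided by its length
([is_derive_level_at], [normal_sqr]); off the sphere it is only an extension
that is differentiable wherever [ucoord] is. *)
Definition unit_normal p : 'rV[R]_3 :=
  frame_comb p ((xc p + k * yc p * ucoord p) / rad)
    ((yc p - k * xc p * ucoord p) / rad) (ucoord p / rad).

Lemma ucoordE p u : tc p = height u -> ucoord p = u.
Proof. by rewrite /ucoord => ->; rewrite heightK. Qed.

Lemma differentiable_ucoord p u : tc p = height u -> differentiable ucoord p.
Proof.
move=> hu; apply: differentiable_comp; first exact: differentiable_tc.
rewrite hu; apply/derivable1_diffP.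
by have [] := is_derive_height_inv u.
Qed.

Lemma is_derive_ucoord p u w : tc p = height u ->
  is_derive p w ucoord ((height' u)^-1 * tc w).
Proof.
move=> hu; apply: is_derive_comp_scal (differentiable_tc _) _.
by rewrite hu; exact: is_derive_height_inv.
Qed.

Lemma differentiable_unit_normal p u : tc p = height u ->
  differentiable unit_normal p.
Proof.
move=> hu.
have -> : unit_normal = (fun q => vec3
   ((xc q + k * yc q * ucoord q) / rad / eps)
   ((yc q - k * xc q * ucoord q) / rad / eps)
   (eps ^+ 2 / rad * ucoord q * (1 + k ^+ 2 * (xc q ^+ 2 + yc q ^+ 2)))).
  apply/funext => q; rewrite /unit_normal frame_combE //; congr (vec3 _ _ _).
  by field.
have du := differentiable_ucoord hu.
by apply: differentiable_vec3; differentiable_tac.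
Qed.

Definition sphere_point p u :=
  tc p = height u /\ level (xc p) (yc p) u = rad ^+ 2.

Lemma sphere_omega p u : sphere_point p u ->
  omega eps tau rad ^+ 2 =
  (1 + k ^+ 2 * (xc p ^+ 2 + yc p ^+ 2)) * (1 + k ^+ 2 * u ^+ 2).
Proof. by move=> [_ hl]; rewrite sqr_omega -hl /level; ring. Qed.

Definition level_at q := level (xc q) (yc q) (ucoord q).

(** The factor in parentheses is the scalar product with the normal direction,
so [tangentP] and the sign of [level_at] along the normal both follow. *)
Lemma is_derive_level_at p u (w1 w2 w3 : R) : sphere_point p u ->
  is_derive p (frame_comb p w1 w2 w3) level_at
  (2 * (1 + k ^+ 2 * u ^+ 2) / eps * ((xc p + k * yc p * u) * w1 +
      (yc p - k * xc p * u) * w2 + u * w3)).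
Proof.
move=> hp; have [hu hl] := hp; have [r1 u1] := (r1_neq0 p, u1_neq0 u).
have du := is_derive_ucoord (frame_comb p w1 w2 w3) hu.
rewrite /level_at /level; apply: is_derive_eq.
rewrite (ucoordE hu) frame_combE // !coordE /height' (sphere_omega hp).
by rewrite /GRing.scale /=; field; rewrite en0 exprMn u1 r1.
Qed.

Lemma differentiable_level_at p u : tc p = height u -> differentiable level_at p.
Proof.
move=> hu; have du := differentiable_ucoord hu.
by rewrite /level_at /level; differentiable_tac.
Qed.

Lemma level_at_sphere q : S q -> level_at q = rad ^+ 2.
Proof. by move=> /sphereP[u hu]; rewrite /level_at (ucoordE hu). Qed.

Lemma frame_comb_surj p w : exists w1 w2 w3 : R, w = frame_comb p w1 w2 w3.
Proof.
exists (eps * xc w), (eps * yc w),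
  ((tc w - tau * eps ^+ 4 * (xc w * yc p - yc w * xc p)) / eps ^+ 2).
by apply: row3P; rewrite frame_combE // !coordE; field.
Qed.

(** In the coordinates [(x, y, u)], take the straight line with velocity
[(v1, v2, v3)] and rescale its points by the positive number [lam] that brings
them back to the surface.  The squared factor is the root [L] of
[B L^2 + A L = rad^2], where [A] and [B] are the parts of degree two and four of
[level] at the point.  Tangency says that [A + B] is stationary at the initial
point, where [L = 1]; so [lam] is stationary there too and the projected curve
starts with the velocity of the line. *)
Lemma sphere_curve p u (v1 v2 v3 : R) : sphere_point p u ->
  (1 + k ^+ 2 * u ^+ 2) * (xc p * v1 + yc p * v2) +
    (1 + k ^+ 2 * (xc p ^+ 2 + yc p ^+ 2)) * (u * v3) = 0 ->
  tangent S p (vec3 v1 v2 (height' u * v3)).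
Proof.
move=> [hu hl] hv; set x := xc p in hl hv; set y := yc p in hl hv.
pose A s := (x + s * v1) ^+ 2 + (y + s * v2) ^+ 2 + (u + s * v3) ^+ 2.
pose B s := k ^+ 2 * ((x + s * v1) ^+ 2 + (y + s * v2) ^+ 2) * (u + s * v3) ^+ 2.
pose Q s := Num.sqrt (A s ^+ 2 + 4 * rad ^+ 2 * B s).
(* The root of the quadratic in the form that allows [B s = 0]. *)
pose lam s := Num.sqrt (2 * rad ^+ 2 / (A s + Q s)).
pose dA := 2 * (x * v1 + y * v2 + u * v3).
pose dB := k ^+ 2 * (2 * (x * v1 + y * v2) * u ^+ 2 +
   (x ^+ 2 + y ^+ 2) * (2 * u * v3)).
have A0 : A 0 = x ^+ 2 + y ^+ 2 + u ^+ 2 by rewrite /A !mul0r !addr0.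
have B0 : B 0 = k ^+ 2 * (x ^+ 2 + y ^+ 2) * u ^+ 2.
  by rewrite /B !mul0r !addr0.
have AB0 : A 0 + B 0 = rad ^+ 2 by rewrite A0 B0 -hl /level; ring.
have dAB : dA + dB = 0.
  transitivity (2 * 0 : R); last by rewrite mulr0.
  by rewrite -hv /dA /dB; ring.
have Age0 s : 0 <= A s by rewrite !addr_ge0 ?sqr_ge0.
have Bge0 s : 0 <= B s.
  by apply: mulr_ge0 (sqr_ge0 _); apply: mulr_ge0; rewrite ?addr_ge0 ?sqr_ge0.
have R2 : 0 < rad ^+ 2 by rewrite exprn_gt0.
have R4 s : 0 <= 4 * rad ^+ 2 * B s.
  by apply: mulr_ge0 (Bge0 s); apply: mulr_ge0 (ltW R2).
have Agt0 : 0 < A 0.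
  rewrite lt_neqAle Age0 andbT eq_sym; apply/eqP => Ae; move: AB0.
  have [x0 y0 u0] : [/\ x = 0, y = 0 & u = 0].
    move/eqP: Ae; rewrite A0 !paddr_eq0 ?addr_ge0 ?sqr_ge0 // !sqrf_eq0.
    by move=> /andP[/andP[/eqP-> /eqP->] /eqP->].
  rewrite Ae B0 x0 y0 u0; move/eqP.
  by rewrite expr0n mulr0 addr0 eq_sym expf_eq0 (negPf rn0).
have Q2 s : Q s ^+ 2 = A s ^+ 2 + 4 * rad ^+ 2 * B s.
  by rewrite sqr_sqrtr // addr_ge0 ?sqr_ge0.
have Qge0 s : 0 <= Q s by exact: sqrtr_ge0.
have Q0 : Q 0 = A 0 + 2 * B 0.
  have AB2 : 0 <= A 0 + 2 * B 0.
    by apply: addr_ge0 (Age0 0) _; apply: mulr_ge0 (Bge0 0).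
  apply/eqP; rewrite -(@eqrXn2 _ 2) //.
  by rewrite Q2 -AB0; apply/eqP; ring.
have AQgt0 s : 0 < A s -> 0 < A s + Q s.
  by move=> As; rewrite ltr_pwDl.
have lam2 s : 0 < A s -> lam s ^+ 2 * (A s + Q s) = 2 * rad ^+ 2.
  move=> /AQgt0 h; rewrite sqr_sqrtr; last first.
    by apply: divr_ge0 (ltW h); apply: mulr_ge0 (ltW R2).
  by rewrite divfK // gt_eqF.
have lam0 : lam 0 = 1.
  apply/eqP; rewrite -(@eqrXn2 _ 2) ?ler01 ?expr1n //; last exact: sqrtr_ge0.
  apply/eqP.
  apply: (mulIf (lt0r_neq0 (AQgt0 0 Agt0))); rewrite lam2 // Q0 -AB0.
  by ring.
have dlin (a b : R) : is_derive (0 : R) 1 (fun s : R => a + s * b) b.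
  by apply: is_derive_eq; rewrite /GRing.scale /=; ring.
have dAs : is_derive (0 : R) 1 A dA.
  have := (dlin x v1, dlin y v2, dlin u v3) => -[[d1 d2] d3].
  rewrite /A; apply: is_derive_eq; rewrite /GRing.scale /= /dA; ring.
have dBs : is_derive (0 : R) 1 B dB.
  have := (dlin x v1, dlin y v2, dlin u v3) => -[[d1 d2] d3].
  rewrite /B; apply: is_derive_eq; rewrite /GRing.scale /= /dB; ring.
have dQs : is_derive (0 : R) 1 Q (- dA).
  pose f s := A s ^+ 2 + 4 * rad ^+ 2 * B s.
  have df : is_derive (0 : R) 1 f (2 * A 0 * dA + 4 * rad ^+ 2 * dB).
    by rewrite /f; apply: is_derive_eq; rewrite /GRing.scale /=; ring.
  have f0 : 0 < f 0 by rewrite ltr_pwDl ?exprn_gt0.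
  apply: is_derive_eq; first exact: is_derive1_comp (is_derive1_sqrt f0) df.
  have AB2 : A 0 + 2 * B 0 != 0.
    by rewrite gt_eqF // ltr_pwDl //; apply: mulr_ge0 (Bge0 0).
  have -> : dB = - dA by apply/eqP; rewrite -addr_eq0 addrC dAB.
  by rewrite -[Num.sqrt (f 0)]/(Q 0) Q0 -AB0; field.
have dlam : is_derive (0 : R) 1 lam 0.
  pose f s := 2 * rad ^+ 2 / (A s + Q s).
  have AQ0 := AQgt0 0 Agt0; have AQn0 := lt0r_neq0 AQ0.
  have df : is_derive (0 : R) 1 f 0.
    have dAQ : is_derive (0 : R) 1 (fun s => A s + Q s) 0.
      by apply: is_derive_eq; rewrite subrr.
    have dV := is_deriveV (f := fun s => A s + Q s) AQn0 dAQ.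
    by apply: is_derive_eq; rewrite /GRing.scale /= !mulr0 ?addr0 ?mul0r.
  have f0 : 0 < f 0 by apply: divr_gt0 AQ0; apply: mulr_gt0 R2.
  apply: is_derive_eq; first exact: is_derive1_comp (is_derive1_sqrt f0) df.
  exact: mulr0.
exists (fun s => vec3 (lam s * (x + s * v1)) (lam s * (y + s * v2))
   (height (lam s * (u + s * v3)))); split.
- by apply: row3P; rewrite !coordE !mul0r !addr0 lam0 ?mul1r.
- have Anear : \forall s \near (0 : R), 0 < A s.
    have Acont : A s @[s --> (0 : R)] --> A 0.
      by apply/differentiable_continuous/derivable1_diffP; case: dAs.
    exact: (cvgr_gt _ Acont).
  near=> s; apply/sphereP.
  exists (lam s * (u + s * v3)); first by rewrite !coordE.
  have As : 0 < A s by near: s.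
  have lQ : lam s ^+ 2 * Q s = 2 * rad ^+ 2 - lam s ^+ 2 * A s.
    by rewrite -(lam2 _ As); ring.
  have R24 : 4 * rad ^+ 2 != 0 :> R by rewrite mulf_neq0 ?gt_eqF.
  apply: (mulfI R24); apply/eqP; rewrite !coordE -subr_eq0.
  rewrite [X in X == 0](_ : _ = (lam s ^+ 2 * Q s) ^+ 2 -
    (2 * rad ^+ 2 - lam s ^+ 2 * A s) ^+ 2).
    by rewrite lQ subrr.
  by rewrite (exprMn 2 _ (Q s)) Q2 /level /B /A; ring.
- have [d1 d2 d3] := And3 (dlin x v1) (dlin y v2) (dlin u v3).
  apply: is_derive_vec3.
  + by apply: is_derive_eq; rewrite lam0 /GRing.scale /=; ring.
  + by apply: is_derive_eq; rewrite lam0 /GRing.scale /=; ring.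
  + have dz : is_derive (0 : R) 1 (fun s : R => lam s * (u + s * v3)) v3.
      by apply: is_derive_eq; rewrite lam0 /GRing.scale /=; ring.
    apply: is_derive1_comp dz; rewrite lam0 mul0r addr0 mul1r.
    exact: is_derive_height.
Unshelve. all: by end_near.
Qed.

Lemma tangentP p u (w1 w2 w3 : R) : sphere_point p u ->
  tangent S p (frame_comb p w1 w2 w3) <->
  (xc p + k * yc p * u) * w1 + (yc p - k * xc p * u) * w2 + u * w3 = 0.
Proof.
move=> hp; have [hu hl] := hp; split.
  move=> [gamma [g0 gS gd]].
  have dg : differentiable gamma 0 by apply/derivable1_diffP; case: gd.
  have dlevel := differentiable_level_at hu; rewrite -g0 in dlevel.
  have := is_derive_comp dlevel dg gd.
  rewrite g0; have [_ ->] := is_derive_level_at w1 w2 w3 hp.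
  move=> [_ e1].
  have e2 : 'D_1 (level_at \o gamma) 0 = 0.
    rewrite (near_eq_derive (g := cst (rad ^+ 2))) ?derive_cst //.
    by apply: filterS gS => s; exact: level_at_sphere.
  move/eqP: e1; rewrite e2 eq_sym mulf_eq0.
  case/orP => [|/eqP //]; rewrite !mulf_eq0 invr_eq0 (negPf en0).
  by rewrite (negPf (u1_neq0 u)) pnatr_eq0.
move=> hw; rewrite frame_combE //.
have h'0 : height' u != 0 by rewrite gt_eqF ?height'_gt0.
rewrite -[X in vec3 _ _ X](mulVKf h'0); apply: sphere_curve => //.
have [r1 u1] := (r1_neq0 p, u1_neq0 u).
rewrite /height' (sphere_omega hp).
transitivity ((1 + k ^+ 2 * u ^+ 2) / eps * 0); last by rewrite mulr0.
by rewrite -hw; field; rewrite en0 exprMn u1 r1.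
Qed.

(** * The exterior normal and the shape operator *)

Lemma frame_comb_lin p (a b v1 v2 v3 w1 w2 w3 : R) :
  a *: frame_comb p v1 v2 v3 + b *: frame_comb p w1 w2 w3 =
  frame_comb p (a * v1 + b * w1) (a * v2 + b * w2) (a * v3 + b * w3).
Proof. by apply: row3P; rewrite !frame_combE // !coordE; ring. Qed.

Lemma frame_combZ p (a v1 v2 v3 : R) :
  a *: frame_comb p v1 v2 v3 = frame_comb p (a * v1) (a * v2) (a * v3).
Proof. by apply: row3P; rewrite !frame_combE // !coordE; ring. Qed.

Lemma sphere_pointP p : S p -> exists u, sphere_point p u.
Proof. by move=> /sphereP[u hu hl]; exists u. Qed.

Lemma unit_normalE p u : sphere_point p u -> unit_normal p =
  frame_comb p ((xc p + k * yc p * u) / rad) ((yc p - k * xc p * u) / rad)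
    (u / rad).
Proof. by move=> [hu _]; rewrite /unit_normal (ucoordE hu). Qed.

Lemma normal_sqr p u : sphere_point p u ->
  (xc p + k * yc p * u) ^+ 2 + (yc p - k * xc p * u) ^+ 2 + u ^+ 2 = rad ^+ 2.
Proof. by move=> [_ <-]; rewrite /level; ring. Qed.

Lemma is_derive_line p n : is_derive (0 : R) (1 : R) (fun s : R => p + s *: n) n.
Proof.
have -> : (fun s : R => p + s *: n) = (fun s => vec3 (xc p + s * xc n)
    (yc p + s * yc n) (tc p + s * tc n)).
  by apply/funext => s; apply: row3P; rewrite !coordE.
have dlin (a b : R) : is_derive (0 : R) 1 (fun s : R => a + s * b) b.
  by apply: is_derive_eq; rewrite /GRing.scale /=; ring.
rewrite [X in is_derive _ _ _ X]vec3_eta.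
exact: is_derive_vec3.
Qed.

(** The slope of [level_at] along a multiple of the normal has the sign of the
multiple, which is how the two sides of the sphere are told apart. *)
Lemma is_derive_level_at_normal p u (c : R) : sphere_point p u ->
  is_derive (0 : R) (1 : R)
    (fun s : R => level_at (p + s *: (c *: unit_normal p)))
    (c * (2 * (1 + k ^+ 2 * u ^+ 2) / eps * rad)).
Proof.
move=> hp; have [hu hl] := hp.
set n := c *: _; have dl := is_derive_line p n.
have p0 : p + 0 *: n = p by rewrite scale0r addr0.
have dlevel := differentiable_level_at hu; rewrite -p0 in dlevel.
have dl' : differentiable (fun s : R => p + s *: n) 0.
  by apply/derivable1_diffP; case: dl.
apply: is_derive_eq; first
  exact: (is_derive_comp (g := fun s : R => p + s *: n) dlevel dl' dl).
cbv beta; rewrite p0 /n (unit_normalE hp) frame_combZ.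
have [_ ->] := is_derive_level_at (c * ((xc p + k * yc p * u) / rad))
  (c * ((yc p - k * xc p * u) / rad)) (c * (u / rad)) hp.
transitivity (c * (2 * (1 + k ^+ 2 * u ^+ 2) / eps * (rad ^+ 2 / rad))).
  by rewrite -(normal_sqr hp); field; rewrite rn0.
by rewrite expr2 mulfK.
Qed.

Lemma level_at_slope_gt0 u : 0 < 2 * (1 + k ^+ 2 * u ^+ 2) / eps * rad.
Proof.
by apply: mulr_gt0 hrad; apply: divr_gt0 heps; apply: mulr_gt0 (oneDksqr_gt0 _).
Qed.

Lemma unit_normal_exits p u : sphere_point p u ->
  \forall s \near (0 : R)^'+, ~ D (p + s *: unit_normal p).
Proof.
move=> hp; have dn := is_derive_level_at_normal 1 hp.
have := is_derive_gt_right dn; rewrite scale1r mul1r scale0r addr0 => hs.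
apply: filterS (hs (level_at_slope_gt0 u)) => s.
have Sp : S p by apply/sphereP => //; case: hp => hu hl; exists u.
rewrite level_at_sphere // => hlt /ball_regionP[v hv].
by rewrite leNgt; move: hlt; rewrite /level_at (ucoordE hv) => ->.
Qed.

(** Points with a small level belong to the ball only if their height is in the
image of [height], which holds near [tc p] because [height] is strictly
increasing. *)
Lemma opp_unit_normal_enters p u : sphere_point p u ->
  \forall s \near (0 : R)^'+, D (p + s *: - unit_normal p).
Proof.
move=> hp; have [hu hl] := hp.
set n := - unit_normal p.
have nE : n = (-1) *: unit_normal p by rewrite scaleN1r.
have dn := is_derive_level_at_normal (-1) hp; rewrite -nE in dn.
have dn' : is_derive (0 : R) (1 : R) (fun s : R => - level_at (p + s *: n))
    (2 * (1 + k ^+ 2 * u ^+ 2) / eps * rad).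
  by apply: is_derive_eq; rewrite mulN1r opprK.
have := is_derive_gt_right dn' (level_at_slope_gt0 u).
rewrite scale0r addr0 => hs.
have Sp : S p by apply/sphereP => //; exists u.
have tcont : tc (p + s *: n) @[s --> (0 : R)] --> tc p.
  have dt : differentiable (@tc R \o (fun s : R => p + s *: n)) 0.
    apply: differentiable_comp (differentiable_tc _).
    by apply/derivable1_diffP; case: (is_derive_line p n).
  have : tc (p + s *: n) @[s --> (0 : R)] --> tc (p + 0 *: n).
    exact: differentiable_continuous dt.
  by rewrite scale0r addr0.
have tbound : \forall s \near (0 : R)^'+, `|tc (p + s *: n)| < height (`|u| + 1).
  have : `|tc (p + s *: n)| @[s --> (0 : R)^'+] --> `|tc p|.
    by apply: cvg_norm; exact: cvg_at_right_filter tcont.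
  move=> h; apply: (cvgr_lt _ h); rewrite hu norm_height // lt_height //.
  by rewrite ltrDl.
near=> s.
have [v hv _] : exists2 v, height v = tc (p + s *: n) & `|v| <= `|u| + 1.
  by apply: height_surj => //; apply: ltW; near: s.
apply/ball_regionP => //; exists v => //.
have : - level_at p < - level_at (p + s *: n) by near: s.
by rewrite ltrN2 (level_at_sphere Sp) /level_at (ucoordE (esym hv)) => /ltW.
Unshelve. all: by end_near. Qed.

(** The component of a unit normal [n] orthogonal to [unit_normal p] is tangent,
hence zero; so [n] is plus or minus [unit_normal p], and the minus sign is
excluded because that vector enters the ball. *)
Lemma is_exterior_unit_normalP p n : S p ->
  is_exterior_unit_normal g S D p n <-> n = unit_normal p.
Proof.
move=> /sphere_pointP[u hp].
have N2 := normal_sqr hp; have nE := unit_normalE hp; have tP := tangentP _ _ _ hp.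
move: N2 nE tP; set N1 := xc p + _; set N2 := yc p - _ => Nsq nE tP.
split; last first.
  move=> ->; split; last exact: unit_normal_exits hp.
    rewrite nE inner_frame_comb //.
    transitivity (rad ^+ 2 / rad ^+ 2); last by rewrite divff ?expf_neq0.
    by rewrite -{1}Nsq; field.
  move=> w; have [w1 [w2 [w3 ->]]] := frame_comb_surj p w.
  move=> /tP hw; rewrite nE inner_frame_comb //.
  by transitivity (0 / rad); [rewrite -hw; field|rewrite mul0r].
have [n1 [n2 [n3 ->]]] := frame_comb_surj p n.
move=> [nn nt nD]; rewrite inner_frame_comb // in nn.
pose d := (N1 * n1 + N2 * n2 + u * n3) / rad.
pose w1 := n1 - d * N1 / rad; pose w2 := n2 - d * N2 / rad.
pose w3 := n3 - d * u / rad.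
have tw : tangent S p (frame_comb p w1 w2 w3).
  apply/tP; transitivity (d * rad - d * rad ^+ 2 / rad).
    by rewrite -Nsq /w1 /w2 /w3 /d; field.
  by field.
have := nt _ tw; rewrite inner_frame_comb // => nw.
have d2 : d ^+ 2 = 1.
  have : n1 * n1 + n2 * n2 + n3 * n3 - (n1 * w1 + n2 * w2 + n3 * w3) = d ^+ 2.
    by rewrite /w1 /w2 /w3 /d; field.
  by rewrite nn nw subr0.
have : w1 ^+ 2 + w2 ^+ 2 + w3 ^+ 2 = 0.
  transitivity ((n1 * n1 + n2 * n2 + n3 * n3) - 2 * d ^+ 2 +
     d ^+ 2 * (N1 ^+ 2 + N2 ^+ 2 + u ^+ 2) / rad ^+ 2).
    by rewrite /w1 /w2 /w3 /d; field.
  by rewrite nn d2 Nsq; field.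
move/eqP; rewrite !paddr_eq0 ?addr_ge0 ?sqr_ge0 // !sqrf_eq0 !subr_eq0.
move=> /andP[/andP[/eqP e1 /eqP e2] /eqP e3].
have nd : frame_comb p n1 n2 n3 = d *: unit_normal p.
  by rewrite nE frame_combZ e1 e2 e3 !mulrA.
rewrite nd; move/eqP: d2; rewrite sqrf_eq1 => /orP[/eqP->|/eqP dm].
  by rewrite scale1r.
move: nD; rewrite nd dm scaleN1r => nD; exfalso.
have : \forall s \near (0 : R)^'+, False.
  by apply: filterS2 nD (opp_unit_normal_enters hp) => s.
by move=> /filter_ex[].
Qed.

Lemma exterior_unit_normalE p : S p ->
  exterior_unit_normal g S D p = unit_normal p.
Proof.
move=> Sp; apply: xget_unique.
  exact/(is_exterior_unit_normalP _ Sp).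
by move=> n /(is_exterior_unit_normalP _ Sp).
Qed.

Lemma normal_extensionP p : S p ->
  differentiable (normal_extension g S D p) p /\
  \forall q \near p, S q -> normal_extension g S D p q = unit_normal q.
Proof.
move=> Sp; have [u [hu hl]] := sphere_pointP Sp.
have [dV hV] : [set V : 'rV[R]_3 -> 'rV[R]_3 | differentiable V p /\
    \forall q \near p, S q -> V q = exterior_unit_normal g S D q]
    (normal_extension g S D p).
  apply: xgetPex; exists unit_normal; split.
    exact: differentiable_unit_normal hu.
  by near=> q => Sq; rewrite exterior_unit_normalE.
split=> //; apply: filterS hV => q hq Sq.
by rewrite hq // exterior_unit_normalE.
Unshelve. all: by end_near. Qed.

Lemma shape_linear p (a b : R) (v w : 'rV[R]_3) : S p ->
  shape p (a *: v + b *: w) = a *: shape p v + b *: shape p w.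
Proof. by move=> /normal_extensionP[dV _]; exact: levi_civita_linear. Qed.

(** Along a curve of the sphere the chosen extension and [unit_normal] coincide,
so they have the same derivative in every tangent direction, and the
Christoffel terms only involve their common value. *)
Lemma shape_unit_normal p w : S p -> tangent S p w ->
  shape p w = levi_civita g unit_normal p w.
Proof.
move=> Sp [gamma [g0 gS gd]]; have [dV hV] := normal_extensionP Sp.
have [u [hu hl]] := sphere_pointP Sp.
have dN := differentiable_unit_normal hu.
rewrite /Defs.shape; set V := normal_extension _ _ _ _ in dV hV *.
have Vp : V p = unit_normal p by apply: (nbhs_singleton hV).
rewrite /levi_civita Vp; congr (_ + _).
have dg : differentiable gamma 0 by apply/derivable1_diffP; case: gd.
have [dV' dN'] : differentiable V (gamma 0) /\ differentiable unit_normal (gamma 0).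
  by rewrite g0.
have [_ e1] := is_derive_comp dV' dg gd.
have [_ e2] := is_derive_comp dN' dg gd.
rewrite -g0 -e1 -e2; apply: near_eq_derive.
have gc : gamma s @[s --> (0 : R)] --> p.
  by rewrite -g0; exact: differentiable_continuous.
have := gc _ hV; rewrite /= => hV'.
by apply: filterS2 gS hV' => s Ss; apply.
Qed.

(** The differential of [ucoord] at a point of the sphere, evaluated on
[frame_comb p w1 w2 w3]. *)
Definition ducoord p u (w1 w2 w3 : R) : R :=
  (1 + k ^+ 2 * u ^+ 2) / (1 + k ^+ 2 * (xc p ^+ 2 + yc p ^+ 2)) *
  (tau * (yc p * w1 - xc p * w2) + w3 / eps).

(** Differentiating the [u]-linear terms of the normal gives [k u dy] and
[- k u dx]; since [dx = w1 / eps], [dy = w2 / eps] and [k / eps = tau], these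
cancel the connection terms [- tau w2 u] and [tau w1 u]. *)
Lemma shape_frame_comb p u (w1 w2 w3 : R) : sphere_point p u ->
  tangent S p (frame_comb p w1 w2 w3) ->
  shape p (frame_comb p w1 w2 w3) =
  rad^-1 *: frame_comb p
    (w1 / eps + k * yc p * ducoord p u w1 w2 w3 - tau * w3 * (yc p - k * xc p * u))
    (w2 / eps - k * xc p * ducoord p u w1 w2 w3 + tau * w3 * (xc p + k * yc p * u))
    (ducoord p u w1 w2 w3 + tau * ((xc p + k * yc p * u) * w2 -
       (yc p - k * xc p * u) * w1)).
Proof.
move=> hp; have [hu hl] := hp.
have Sp : S p by apply/sphereP => //; exists u.
move=> tw; rewrite shape_unit_normal //; set w := frame_comb p w1 w2 w3.
have dU := is_derive_ucoord w hu.
have tcw : (height' u)^-1 * tc w = ducoord p u w1 w2 w3.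
  have [r1 u1] := (r1_neq0 p, u1_neq0 u).
  rewrite /w frame_combE // coordE /height' (sphere_omega hp) /ducoord.
  by field; rewrite en0 r1 (exprMn 2 k u) u1.
rewrite {}tcw in dU; set d := ducoord _ _ _ _ _ in dU *.
have [xw yw] : xc w = w1 / eps /\ yc w = w2 / eps.
  by rewrite /w frame_combE // !coordE.
have uE := ucoordE hu.
have d1 : is_derive p w (fun q => (xc q + k * yc q * ucoord q) / rad)
    ((w1 / eps + k * (w2 / eps) * u + k * yc p * d) / rad).
  by apply: is_derive_eq; rewrite xw yw uE /GRing.scale /=; ring.
have d2 : is_derive p w (fun q => (yc q - k * xc q * ucoord q) / rad)
    ((w2 / eps - k * (w1 / eps) * u - k * xc p * d) / rad).
  by apply: is_derive_eq; rewrite xw yw uE /GRing.scale /=; ring.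
have d3 : is_derive p w (fun q => ucoord q / rad) (d / rad).
  by apply: is_derive_eq; rewrite /GRing.scale /=; ring.
have -> := levi_civita_frame d1 d2 d3.
by rewrite frame_combZ uE; congr (frame_comb _ _ _ _); field;
  rewrite ?en0 rn0.
Qed.

(** * Orthonormal frames of principal directions *)

Implicit Types v : 'rV[R]_3.

Lemma innerDZl p (a b : R) v w z :
  inner g p (a *: v + b *: w) z = a * inner g p v z + b * inner g p w z.
Proof. by rewrite /inner !mulmxDl -!scalemxAl !mxE. Qed.

Lemma innerC p v w : inner g p v w = inner g p w v.
Proof.
have [v1 [v2 [v3 ->]]] := frame_comb_surj p v.
have [w1 [w2 [w3 ->]]] := frame_comb_surj p w.
by rewrite !inner_frame_comb //; ring.
Qed.

Lemma innerDZr p (a b : R) v w z :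
  inner g p z (a *: v + b *: w) = a * inner g p z v + b * inner g p z w.
Proof. by rewrite innerC innerDZl !(innerC _ z). Qed.

Lemma tangentDZ p (a b : R) v w : S p -> tangent S p v -> tangent S p w ->
  tangent S p (a *: v + b *: w).
Proof.
move=> /(sphere_pointP)[u hp].
have [v1 [v2 [v3 ->]]] := frame_comb_surj p v.
have [w1 [w2 [w3 ->]]] := frame_comb_surj p w.
rewrite frame_comb_lin // !(tangentP _ _ _ hp) => hv hw.
by transitivity (a * 0 + b * 0); [rewrite -{1}hv -hw; ring|rewrite !mulr0 addr0].
Qed.

Definition tangent_orthonormal p v w : Prop :=
  [/\ tangent S p v, tangent S p w, inner g p v v = 1, inner g p w w = 1
    & inner g p v w = 0].

(** Together with the normal, [v] and [w] are the rows of a matrix [M] such that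
[M G M^T = 1]; inverting it expresses [z] by its scalar products with the three
rows, and the one with the normal vanishes. *)
Lemma tangent_span p v w z : S p -> tangent_orthonormal p v w ->
  tangent S p z -> exists a b : R, z = a *: v + b *: w.
Proof.
move=> Sp [tv tw vv ww vw] tz.
have [nn nt _] := (is_exterior_unit_normalP _ Sp).2 erefl.
move: (unit_normal p) nn nt => n nn nt.
pose M : 'M[R]_3 := \matrix_(i < 3) [:: v; w; n]`_i.
have innerE (i j : 'I_3) : (M *m (g p *m M^T)) i j =
    inner g p [:: v; w; n]`_i [:: v; w; n]`_j.
  rewrite mulmxA /inner !mxE; apply: eq_bigr => l _; rewrite !mxE.
  by congr (_ * _); apply: eq_bigr => m _; rewrite !mxE.
have MM : M *m (g p *m M^T) = 1%:M.
  apply/matrixP; apply: ord3P; apply: ord3P; rewrite innerE !mxE /=;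
    by rewrite ?vv ?ww ?nn ?vw ?(innerC p w v) ?(innerC p v n) ?(innerC p w n)
      ?nt.
have zM : z = z *m (g p *m M^T) *m M by rewrite -mulmxA (mulmx1C MM) mulmx1.
pose c := z *m (g p *m M^T).
exists (c ord0 ord0), (c ord0 (@Ordinal 3 1 isT)).
have c2 : c ord0 (@Ordinal 3 2 isT) = 0.
  rewrite -(nt z tz) innerC /inner /c mulmxA !mxE; apply: eq_bigr => l _.
  by rewrite !mxE.
rewrite [LHS]zM -/c; apply/rowP => j; rewrite !mxE sum3 c2 mul0r addr0.
by rewrite !mxE.
Qed.

Lemma mul_rows2 v w (c : 'rV[R]_2) : c *m (\matrix_(i < 2) [:: v; w]`_i) =
  c ord0 ord0 *: v + c ord0 (lift ord0 ord0) *: w.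
Proof. by apply/rowP => j; rewrite !mxE !big_ord_recl big_ord0 addr0 !mxE. Qed.

Lemma tangent_orthonormal_basis p v w : S p -> tangent_orthonormal p v w ->
  tangent_basis S p (\matrix_(i < 2) [:: v; w]`_i).
Proof.
move=> Sp tvw; have [tv tw vv ww vw] := tvw.
set B := \matrix_(i < 2) _.
have rB c : c *m B = _ := mul_rows2 v w c.
split; last first.
  move=> z; split.
    move=> /(tangent_span Sp tvw)[a [b ->]].
    apply/submxP; exists (\row_(i < 2) [:: a; b]`_i).
    by rewrite rB !mxE.
  by move=> /submxP[c ->]; rewrite rB; exact: tangentDZ.
apply/inj_row_free => c; rewrite rB => c0; apply/rowP => i; rewrite mxE.
have := congr1 (fun z => inner g p z v) c0.
have := congr1 (fun z => inner g p z w) c0.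
have i0 z : inner g p 0 z = 0 by rewrite /inner !mul0mx mxE.
rewrite /= !innerDZl !i0 vv ww (innerC _ w v) vw !mulr0 !mulr1 addr0 add0r.
move=> c1 c0'; case: i => [[|[|//]]] hi.
  by rewrite -[RHS]c0'; congr (c _ _); apply: val_inj.
by rewrite -[RHS]c1; congr (c _ _); apply: val_inj.
Qed.

Lemma rotation_orthonormal p v w (c s : R) : S p -> c ^+ 2 + s ^+ 2 = 1 ->
  tangent_orthonormal p v w ->
  tangent_orthonormal p (c *: v + s *: w) (- s *: v + c *: w).
Proof.
move=> Sp cs [tv tw vv ww vw]; split; try exact: tangentDZ.
- by rewrite innerDZl !innerDZr vv ww (innerC _ w) vw -[RHS]cs; ring.
- by rewrite innerDZl !innerDZr vv ww (innerC _ w) vw -[RHS]cs; ring.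
- by rewrite innerDZl !innerDZr vv ww (innerC _ w) vw; ring.
Qed.

Definition principal_frame p v w (kv kw : R) : Prop :=
  [/\ tangent_orthonormal p v w, shape p v = kv *: v & shape p w = kw *: w].

Lemma unit_neq0 p v : inner g p v v = 1 -> v != 0.
Proof.
move=> vv; apply/eqP => v0; move: vv; rewrite v0 /inner !mul0mx mxE => /eqP.
by rewrite eq_sym oner_eq0.
Qed.

Lemma principal_frame_mean p v w kv kw : S p -> principal_frame p v w kv kw ->
  is_mean_curvature g S D p ((kv + kw) / 2).
Proof.
move=> Sp [tvw hv hw]; exists (mx22 kv 0 0 kw); split; last first.
  by rewrite /mxtrace !big_ord_recl big_ord0 !mxE /= addr0.
exists (\matrix_(i < 2) [:: v; w]`_i); split.
  exact: tangent_orthonormal_basis.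
set B := \matrix_(i < 2) _ => c.
rewrite !mul_rows2 shape_linear // hv hw !scalerA; congr (_ *: _ + _ *: _).
  by rewrite !mxE !big_ord_recl big_ord0 !mxE /= mulr0 !addr0.
by rewrite !mxE !big_ord_recl big_ord0 !mxE /= mulr0 add0r !addr0.
Qed.

Lemma principal_frame_directions p v w kv kw : principal_frame p v w kv kw ->
  is_principal_direction g S D p kv v /\ is_principal_direction g S D p kw w.
Proof.
by move=> [[tv tw vv ww _] hv hw]; split; split => //; apply: (@unit_neq0 p).
Qed.

Lemma principal_frame_curvatures p v w kv kw : S p ->
  principal_frame p v w kv kw -> forall kk : R,
  is_principal_curvature g S D p kk <-> kk = kv \/ kk = kw.
Proof.
move=> Sp pf kk; have [dv dw] := principal_frame_directions pf.
split; last first.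
  by case=> ->; [exists v|exists w].
move=> [z [tz z0 hz]]; have [tvw hv hw] := pf; have [tv tw vv ww vw] := tvw.
have [a [b zE]] := tangent_span Sp tvw tz.
have [kva|kva] := eqVneq kk kv; first by left.
have [kwb|kwb] := eqVneq kk kw; first by right.
move: hz; rewrite zE shape_linear // hv hw !scalerA => e.
have ev := congr1 (fun z => inner g p z v) e.
have ew := congr1 (fun z => inner g p z w) e.
move: ev ew; rewrite /= scalerDr !scalerA !innerDZl vv ww (innerC _ w v) vw.
rewrite !mulr0 !mulr1 !addr0 !add0r => ea eb.
have /eqP : (kk - kv) * a = 0 by rewrite mulrBl -ea mulrC subrr.
have /eqP : (kk - kw) * b = 0 by rewrite mulrBl -eb mulrC subrr.
rewrite !mulf_eq0 !subr_eq0 (negPf kva) (negPf kwb) /= => /eqP b0 /eqP a0.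
by move: z0; rewrite zE a0 b0 !scale0r addr0 eqxx.
Qed.

(** * The frame X1, X2 and its rotation by beta *)

Lemma zabs_eq0 p : (zabs p == 0) = (xc p == 0) && (yc p == 0).
Proof.
rewrite -(@sqrf_eq0 _ (zabs p)) sqr_zabs paddr_eq0 ?sqr_ge0 //.
by rewrite !sqrf_eq0.
Qed.

Lemma sphere_star_zabs p : sphere_star eps tau rad p -> 0 < zabs p.
Proof.
move=> [[rR ht] np]; rewrite lt_neqAle zabs_ge0 andbT eq_sym.
apply/negP => z0; apply: np; move: (z0); rewrite zabs_eq0.
move=> /andP[/eqP x0 /eqP y0]; move: ht; rewrite (eqP z0) => ht.
have [t0|t0] := leP 0 (tc p); [left|right] => /=.
  by apply: row3P; rewrite /north !coordE // -ht ger0_norm.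
by apply: row3P; rewrite /south /north !coordE ?oppr0 // -ht ltr0_norm ?opprK.
Qed.

(** All the square roots of the coefficients are gathered in the single factor
[a = omega r / (r omega R)]: on the sphere [b = a u / R] and
[c = a r^2 (1 + k^2 u^2) / R]. *)
Lemma frame_X_comb p u : sphere_point p u -> 0 < zabs p ->
  exists2 a, a ^+ 2 * ((xc p ^+ 2 + yc p ^+ 2) * (1 + k ^+ 2 * u ^+ 2)) = 1 &
  frame_X1 eps tau rad p = frame_comb p (- a * (yc p - k * xc p * u))
     (a * (xc p + k * yc p * u)) 0 /\
  frame_X2 eps tau rad p = frame_comb p (- a * u / rad * (xc p + k * yc p * u))
     (- a * u / rad * (yc p - k * xc p * u))
     (a * (xc p ^+ 2 + yc p ^+ 2) * (1 + k ^+ 2 * u ^+ 2) / rad).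
Proof.
move=> hp r0; have [hu hl] := hp.
have W2 := sphere_omega hp; have q := tsign_sqrt hu hl.
rewrite -sqr_zabs in W2 *; rewrite -sqr_omega // in W2.
have w0 := omega_gt0 (zabs p); have W0 := omega_gt0 rad.
have rn := lt0r_neq0 r0; have wn := lt0r_neq0 w0; have Wn := lt0r_neq0 W0.
set r := zabs p in W2 q r0 w0 rn wn *.
set om := omega eps tau r in W2 q w0 wn *.
set W := omega eps tau rad in W2 W0 Wn.
have PE : 1 + k ^+ 2 * u ^+ 2 = W ^+ 2 / om ^+ 2.
  by rewrite W2 [RHS]mulrC mulKf ?expf_neq0.
have pE : coef_p eps tau rad p = k * u.
  by rewrite /coef_p -/r -/om mulrCA [tsign p * _]mulrA q mulfK.
have bE : coef_b eps tau rad p = u * om / (r * rad * W).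
  by rewrite /coef_b -/r -/om -/W mulrA q.
have cE : coef_c eps tau rad p = r * W / (rad * om) by [].
exists (om / (r * W)).
  by rewrite PE; field; rewrite rn wn Wn.
split; apply: row3P; rewrite /frame_X1 /frame_X2 pE ?bE ?cE /coef_a -/om -/W -/r
  !frame_combE // /fieldX /fieldY /fieldT /sigma !coordE ?PE; field;
  by rewrite ?rn ?wn ?Wn ?en0 ?rn0.
Qed.

Definition mcurv : R := (eps * rad)^-1.
Definition rho2 p : R := k ^+ 2 * (xc p ^+ 2 + yc p ^+ 2).

Lemma frame_X_orthonormal p u : sphere_point p u -> 0 < zabs p ->
  tangent_orthonormal p (frame_X1 eps tau rad p)
    (frame_X2 eps tau rad p).
Proof.
move=> hp r0; have [a a2 [-> ->]] := frame_X_comb hp r0.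
have tP := tangentP _ _ _ hp; have Nsq := normal_sqr hp.
split; rewrite ?tP ?inner_frame_comb //; [by ring|by field| | |by field].
- by rewrite -[RHS]a2; ring.
- rewrite -[RHS]a2; transitivity (a ^+ 2 * ((xc p ^+ 2 + yc p ^+ 2) *
    (1 + k ^+ 2 * u ^+ 2)) * (rad ^+ 2 / rad ^+ 2)); last first.
    by rewrite divff ?mulr1 // expf_neq0.
  by rewrite -{1}Nsq; field.
Qed.

(** The factor [a] of [frame_X_comb] cancels, so both identities are between
rational functions of [x], [y], [u]; the second one uses the equation of the
sphere, in the form [normal_sqr]. *)
Lemma shape_frame_X p u : sphere_point p u -> 0 < zabs p ->
  let X1 := frame_X1 eps tau rad p in
  let X2 := frame_X2 eps tau rad p in
  shape p X1 = (mcurv * (1 + 2 * rho2 p) / (1 + rho2 p)) *: X1 +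
               (tau * rho2 p / (1 + rho2 p)) *: X2 /\
  shape p X2 = (tau * rho2 p / (1 + rho2 p)) *: X1 +
               (mcurv / (1 + rho2 p)) *: X2.
Proof.
move=> hp r0; have [tX1 tX2 _ _ _] := frame_X_orthonormal hp r0.
have [a a2 [X1 X2]] := frame_X_comb hp r0.
move: tX1 tX2; rewrite X1 X2 => t1 t2 /=.
have r1 := r1_neq0 p.
rewrite (shape_frame_comb hp t1).
rewrite (shape_frame_comb hp t2).
have Nsq := normal_sqr hp.
rewrite !frame_comb_lin // !frame_combZ //.
split; congr (frame_comb _ _ _ _); rewrite /ducoord /rho2 /mcurv.
- by field; rewrite ?en0 ?rn0 ?r1.
- by field; rewrite ?en0 ?rn0 ?r1.
- by field; rewrite ?en0 ?rn0 ?r1.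
- by field: (esym Nsq); rewrite ?en0 ?rn0 ?r1.
- by field: (esym Nsq); rewrite ?en0 ?rn0 ?r1.
- by field; rewrite ?en0 ?rn0 ?r1.
Qed.

Definition curv_root : R := Num.sqrt (mcurv ^+ 2 + tau ^+ 2).
Definition kappa1 p : R := mcurv + rho2 p / (1 + rho2 p) * curv_root.
Definition kappa2 p : R := mcurv - rho2 p / (1 + rho2 p) * curv_root.
Definition beta : R := atan (tau / (mcurv + curv_root)).

Lemma mcurv_gt0 : 0 < mcurv. Proof. by rewrite invr_gt0 mulr_gt0. Qed.

Lemma sqr_curv_root : curv_root ^+ 2 = mcurv ^+ 2 + tau ^+ 2.
Proof. by rewrite sqr_sqrtr // addr_ge0 ?sqr_ge0. Qed.

Lemma abs_tau_lt_curv_root : `|tau| < curv_root.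
Proof.
rewrite -(@ltr_pXn2r _ 2) ?nnegrE ?sqrtr_ge0 // sqr_curv_root.
by rewrite real_normK ?num_real // ltrDr exprn_gt0 // mcurv_gt0.
Qed.

Lemma curv_root_gt0 : 0 < curv_root.
Proof. by apply: le_lt_trans abs_tau_lt_curv_root; exact: normr_ge0. Qed.

Lemma mcurv_root_gt0 : 0 < mcurv + curv_root.
Proof. by rewrite addr_gt0 ?mcurv_gt0 ?curv_root_gt0. Qed.

(** The tangent of [beta] is smaller than [1] in absolute value because
[curv_root] already exceeds the absolute value of [tau]. *)
Lemma beta_bounds : - (pi / 4) < beta < pi / 4.
Proof.
have : `|tau / (mcurv + curv_root)| < 1.
  rewrite normrM normfV (gtr0_norm mcurv_root_gt0) ltr_pdivrMr ?mcurv_root_gt0 // mul1r.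
  by apply: lt_trans abs_tau_lt_curv_root _; rewrite ltrDr mcurv_gt0.
rewrite ltr_norml => /andP[lo hi]; rewrite /beta -(@atan1 R) -atanN.
by rewrite !lt_atan.
Qed.

Lemma sin_beta : sin beta = tau / (mcurv + curv_root) * cos beta.
Proof.
have c0 : cos beta != 0.
  rewrite /beta cos_atan invr_eq0 gt_eqF // sqrtr_gt0 ltr_pwDl ?sqr_ge0 //.
by rewrite -[tau / _]atanK -/beta /tan divfK.
Qed.

(** With [m = tan beta], the eigenvector equations reduce to
[mcurv + tau m = curv_root], that is to
[(curv_root - mcurv) (curv_root + mcurv) = tau^2]. *)
Lemma principal_frame_star p : sphere_star eps tau rad p ->
  principal_frame p
    (cos beta *: frame_X1 eps tau rad p + sin beta *: frame_X2 eps tau rad p)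
    (- sin beta *: frame_X1 eps tau rad p + cos beta *: frame_X2 eps tau rad p)
    (kappa1 p) (kappa2 p).
Proof.
move=> Sp; have r0 := sphere_star_zabs Sp.
have [u hp] := sphere_pointP Sp.1.
have [e1 e2] := shape_frame_X hp r0.
have Hd : mcurv + curv_root != 0 by rewrite gt_eqF ?mcurv_root_gt0.
have rho1 : 1 + rho2 p != 0 by exact: r1_neq0.
split.
- apply: rotation_orthonormal => //; first exact: Sp.1.
    exact: cos2Dsin2.
  exact: frame_X_orthonormal hp r0.
- rewrite shape_linear // ?e1 ?e2; last exact: Sp.1.
  move: (frame_X1 _ _ _ _) (frame_X2 _ _ _ _) => X1 X2.
  rewrite !scalerDr !scalerA addrACA -!scalerDl sin_beta /kappa1.
  congr (_ *: _ + _ *: _); field: sqr_curv_root; by rewrite rho1 Hd.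
- rewrite shape_linear // ?e1 ?e2; last exact: Sp.1.
  move: (frame_X1 _ _ _ _) (frame_X2 _ _ _ _) => X1 X2.
  rewrite !scalerDr !scalerA addrACA -!scalerDl sin_beta /kappa2.
  congr (_ *: _ + _ *: _); field: sqr_curv_root; by rewrite rho1 Hd.
Qed.

(** A pole is umbilic: there [x = y = 0], tangent vectors have no [T] component,
and the derivative of the normal is the identity divided by [eps rad]. *)
Lemma principal_frame_pole p : S p -> zabs p = 0 ->
  principal_frame p (frame_comb p 1 0 0) (frame_comb p 0 1 0)
    (kappa1 p) (kappa2 p).
Proof.
move=> Sp /eqP; rewrite zabs_eq0 => /andP[/eqP x0 /eqP y0].
have [u hp] := sphere_pointP Sp.
have tP := tangentP _ _ _ hp.
have t1 : tangent S p (frame_comb p 1 0 0) by apply/tP; rewrite x0 y0; ring.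
have t2 : tangent S p (frame_comb p 0 1 0) by apply/tP; rewrite x0 y0; ring.
have rho0 : rho2 p = 0 by rewrite /rho2 x0 y0; ring.
split.
- by split; rewrite ?inner_frame_comb //; ring.
- rewrite (shape_frame_comb hp t1) !frame_combZ // /kappa1 rho0.
  rewrite x0 y0 /ducoord x0 y0 /mcurv.
  by congr (frame_comb _ _ _ _); field; rewrite rn0 en0.
- rewrite (shape_frame_comb hp t2) !frame_combZ // /kappa2 rho0.
  rewrite x0 y0 /ducoord x0 y0 /mcurv.
  by congr (frame_comb _ _ _ _); field; rewrite rn0 en0.
Qed.

(** On the sphere, [zabs p = 0] holds exactly at the two poles. *)
Lemma principal_frame_ex p : S p -> exists v w,
  principal_frame p v w (kappa1 p) (kappa2 p).
Proof.
move=> Sp; have [z0|zn0] := eqVneq (zabs p) 0.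
  by eexists; eexists; exact: principal_frame_pole.
eexists; eexists; apply: principal_frame_star; split=> // -[] /= pE;
  by move: zn0; rewrite pE zabs_eq0 /south /north !coordE ?oppr0 eqxx.
Qed.

End Sphere.

Theorem theorem3p1 (R : realType) (eps tau rad : R)
    (heps : 0 < eps) (htau : tau != 0) (hrad : 0 < rad) :
  let g := heis_metric eps tau in
  let S := sphere eps tau rad in
  let D := ball_region eps tau rad in
  let X1 := frame_X1 eps tau rad in
  let X2 := frame_X2 eps tau rad in
  let H := (eps * rad)^-1 in
  let rho := fun p : 'rV[R]_3 => tau * eps * zabs p in
  let kappa1 := fun p : 'rV[R]_3 =>
    H + rho p ^+ 2 / (1 + rho p ^+ 2) * Num.sqrt (H ^+ 2 + tau ^+ 2) in
  let kappa2 := fun p : 'rV[R]_3 =>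
    H - rho p ^+ 2 / (1 + rho p ^+ 2) * Num.sqrt (H ^+ 2 + tau ^+ 2) in
  let beta := atan (tau / (H + Num.sqrt (H ^+ 2 + tau ^+ 2))) in
  [/\ forall p, S p -> is_mean_curvature g S D p H,
      forall p, sphere_star eps tau rad p ->
        second_fundamental_form g S D p (X1 p) (X2 p) =
        (1 + rho p ^+ 2)^-1 *:
          mx22 (H * (1 + 2 * rho p ^+ 2)) (tau * rho p ^+ 2)
               (tau * rho p ^+ 2)         H,
      forall p, S p -> forall k : R,
        is_principal_curvature g S D p k <-> k = kappa1 p \/ k = kappa2 p
    & - (pi / 4) < beta < pi / 4 /\
      forall p, sphere_star eps tau rad p ->
        is_principal_direction g S D p (kappa1 p)
          (cos beta *: X1 p + sin beta *: X2 p) /\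
        is_principal_direction g S D p (kappa2 p)
          (- sin beta *: X1 p + cos beta *: X2 p)].
Proof.
move=> g S D X1 X2 H rho k1 k2 b.
have rhoE p : rho p ^+ 2 = rho2 eps tau p by rewrite /rho exprMn sqr_zabs.
have k1E p : k1 p = kappa1 eps tau rad p by rewrite /k1 rhoE.
have k2E p : k2 p = kappa2 eps tau rad p by rewrite /k2 rhoE.
have fr p (Sp : S p) := principal_frame_ex heps htau hrad Sp.
split.
- move=> p Sp; have [v [w pf]] := fr p Sp.
  have := principal_frame_mean heps htau hrad Sp pf.
  by rewrite /kappa1 /kappa2 addrACA subrr addr0 -mulr2n
    -[_ *+ 2]mulr_natr mulfK ?pnatr_eq0.
- move=> p Sp; rewrite rhoE.
  have [u hp] := sphere_pointP heps htau hrad Sp.1.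
  have r0 := sphere_star_zabs Sp.
  have [_ _ X11 X22 X12] := frame_X_orthonormal heps htau hrad hp r0.
  have [e1 e2] := shape_frame_X heps htau hrad hp r0.
  rewrite /second_fundamental_form /X1 /X2 /g e1 e2.
  move: X11 X22 X12; move: (frame_X1 _ _ _ _) (frame_X2 _ _ _ _) => Y1 Y2.
  move=> Y11 Y22 Y12; rewrite !innerDZl Y11 Y22 (innerC tau heps p Y2) Y12.
  apply/matrixP => i j; rewrite !mxE /mcurv -/H.
  by case: ifP => _; case: ifP => _; ring.
- move=> p Sp kk; have [v [w pf]] := fr p Sp.
  by rewrite k1E k2E; exact: principal_frame_curvatures pf _.
- split; first exact: beta_bounds.
  move=> p Sp; rewrite k1E k2E.
  exact: principal_frame_directions (principal_frame_star heps htau hrad Sp).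
Qed.
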